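(* Let $K\ge 1$, $K'\ge 0$, let $p\ge 1$ be an integer, and let $F(z)=\sum_{k=1}^p |z|^{2(k-1)}G_{p-k+1}(z)$ be a poly $(K,K')$-elliptic harmonic mapping in $\mathbb{D}$ (so each $G_{p-k+1}$, $k\in\{1,\dots,p\}$, is a $(K,K')$-elliptic harmonic mapping in $\mathbb{D}$) such that $F(0)=0$, $\lambda_F(0)=1$ and such that, for real constants $\Lambda_{p-k+1}$ ($2\le k\le p$) and $M_p$: (i) $G_{p-k+1}(0)=0$ for all $k\in\{1,\dots,p\}$; (ii) $\lambda_{G_{p-k+1}}(z)\le\Lambda_{p-k+1}$ for all $k\in\{2,\dots,p\}$ and $|G_p(z)|\le M_p$, for all $z\in\mathbb{D}$. Put $\Lambda_{p-k+1}'=\frac12\left(K\Lambda_{p-k+1}+\sqrt{K^2\Lambda_{p-k+1}^2+4K'}\right)$ for $k\in\{2,\dots,p\}$. Then $F$ is univalent in $\mathbb{D}_{r_2}$, where $r_2$ is the unique root in $(0,1)$ of the equation $$1-\sqrt{2M_p^2-2}\cdot\frac{r\sqrt{r^4-3r^2+4}}{(1-r^2)^{3/2}}-\sum_{k=2}^p(2k-1)\Lambda_{p-k+1}'r^{2(k-1)}=0.$$ Furthermore, $F(\mathbb{D}_{r_2})$ contains a schlicht disk with radius $$R_2=r_2-\sqrt{2M_p^2-2}\cdot\frac{r_2^2}{\sqrt{1-r_2^2}}-\sum_{k=2}^p r_2^{2k-1}\Lambda_{p-k+1}'.$$ When $K=1$, $K'=0$ and $M_p=1$, the result is sharp, i.e.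 neither the univalence radius $r_2$ nor the schlicht disk radius $R_2$ can be replaced by a larger number.
   Context: $\mathbb{D}_r=\{z\in\mathbb{C}:|z|<r\}$, $\mathbb{D}=\mathbb{D}_1$. For a continuously differentiable complex-valued $f$ put $\Lambda_f(z)=|f_z(z)|+|f_{\bar z}(z)|$, $\lambda_f(z)=\big||f_z(z)|-|f_{\bar z}(z)|\big|$, $J_f(z)=|f_z(z)|^2-|f_{\bar z}(z)|^2$. Univalent means injective. A mapping $f$ is ACL in $\mathbb{D}$ if for every closed rectangle $R\subset\mathbb{D}$ with sides parallel to the axes, $f$ is absolutely continuous on almost every horizontal and almost every vertical line in $R$; $f\in ACL^2$ if moreover its partial derivatives are locally $L^2$ in $\mathbb{D}$. A sense-preserving continuous mapping $f:\mathbb{D}\to\mathbb{C}$ is $(K,K')$-elliptic ($K\ge1$, $K'\ge0$) if (1) $f$ is $ACL^2$ in $\mathbb{D}$ and $J_f\ne0$ a.e. in $\mathbb{D}$; and (2) $\Lambda_f^2\le KJ_f+K'$ a.e. in $\mathbb{D}$. (For a continuously differentiable $f$, which is automatically $ACL^2$, sense-preserving is taken to mean $J_f\ge 0$, so that $J_f>0$ a.e.) A harmonic mapping is a twice continuously differentiable complex-valued $f$ with $\Delta f=4f_{z\bar z}=0$. A poly $(K,K')$-elliptic harmonic mapping in $\mathbb{D}$ is a mapping of the form $F(z)=\sum_{k=1}^p|z|^{2(k-1)}G_{p-k+1}(z)$ with each $G_{p-k+1}$ a $(K,K')$-elliptic harmonic mapping in $\mathbb{D}$. A schlicht disk contained in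 $F(\mathbb{D}_r)$ is a disk which is the univalent image under $F$ of some region in $\mathbb{D}_r$. In the sharpness assertion the schlicht disk is understood to be centred at $F(0)=0$. Empty sums are $0$.
   Formalization: If M_p=1 and the sum of (2k-1)Λ'_{p-k+1} over 2≤k≤p is at most 1, the equation has no root in (0,1) (e.g. p=1, F(z)=z); existence of r_2 is asserted exactly outside this case, and the other claims hold for the root r_2 whenever it exists. *)

(* Defs.v *)
From HB Require Import structures.
From mathcomp Require Import all_boot all_order all_algebra.
From mathcomp Require Import all_classical all_reals all_analysis.
From mathcomp Require Export complex.
Import Order.TTheory GRing.Theory Num.Theory.
Import numFieldNormedType.Exports.

Set Implicit Arguments.
Unset Strict Implicit.
Unset Printing Implicit Defensive.

Local Open Scope classical_set_scope.
Local Open Scope ring_scope.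
Local Open Scope complex_scope.

(* The library attaches the norm topology to a numClosedFieldType and not to
   the bare carrier R[i], hence this packaging of the complex plane. *)
Definition cplane (R : realType) : numClosedFieldType := R[i].

Section plane.
Context {R : realType}.
Local Notation Re := (@complex.Re R).
Local Notation Im := (@complex.Im R).
Implicit Types (f : R[i] -> R[i]) (z w : R[i]).

(* The norm `|z| of the library is R[i]-valued; this one is R-valued. *)
Definition cabs z : R := Re `|z|.

Definition cdisk w (r : R) : set R[i] := [set z | cabs (z - w) < r].

Definition Dr (r : R) : set R[i] := cdisk 0 r.

Local Notation unit_disk := (Dr 1).

Definition ccontinuous_at f z : Prop :=
  {for z, continuous (f : cplane R -> cplane R)}.

(* Planar Lebesgue measure lives on R * R. *)
Definition complex_of_pair (q : R * R) : R[i] := q.1 +i* q.2.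

Definition area :
  {measure set (measurableTypeR R * measurableTypeR R) -> \bar R} :=
  (@lebesgue_measure R \x @lebesgue_measure R)%E.

Definition ae_in (A : set R[i]) (P : R[i] -> Prop) : Prop :=
  {ae area, forall q, A (complex_of_pair q) -> P (complex_of_pair q)}.

Definition horiz_line f (y : R) : R -> R[i] := fun t => f (t +i* y).
Definition vert_line f (x : R) : R -> R[i] := fun t => f (x +i* t).

Definition cderivable (g : R -> R[i]) (t : R) : Prop :=
  derivable (Re \o g : R -> R) t 1 /\
  derivable (Im \o g : R -> R) t 1.

Definition cderive (g : R -> R[i]) (t : R) : R[i] :=
  derive1 (Re \o g : R -> R) t +i* derive1 (Im \o g : R -> R) t.

Definition dx f z : R[i] := cderive (horiz_line f (Im z)) (Re z).
Definition dy f z : R[i] := cderive (vert_line f (Re z)) (Im z).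

(* Not the library's generic 'i, which is only some square root of -1. *)
Local Notation I := (0 +i* 1 : R[i]).

Definition dz f z : R[i] := (dx f z - I * dy f z) / 2.
Definition dzbar f z : R[i] := (dx f z + I * dy f z) / 2.

Definition bigLambda f z : R := cabs (dz f z) + cabs (dzbar f z).
Definition lambda f z : R := `|cabs (dz f z) - cabs (dzbar f z)|.
Definition wirtinger_jac f z : R := cabs (dz f z) ^+ 2 - cabs (dzbar f z) ^+ 2.

Definition C1_on (A : set R[i]) f : Prop := forall z, A z ->
  [/\ cderivable (horiz_line f (Im z)) (Re z),
      cderivable (vert_line f (Re z)) (Im z),
      ccontinuous_at (dx f) z & ccontinuous_at (dy f) z].

Definition C2_on (A : set R[i]) f : Prop :=
  [/\ C1_on A f, C1_on A (dx f) & C1_on A (dy f)].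

Definition laplacian f z : R[i] := dx (dx f) z + dy (dy f) z.

Definition harmonic_mapping f : Prop :=
  C2_on unit_disk f /\ forall z, unit_disk z -> laplacian f z = 0.

Definition abs_continuous (a b : R) (g : R -> R[i]) : Prop :=
  forall e : R, 0 < e -> exists2 d : R, 0 < d &
    forall (n : nat) (s t : 'I_n -> R),
      (forall i, a <= s i /\ s i <= t i /\ t i <= b) ->
      trivIset setT (fun i => `]s i, t i[%classic) ->
      \sum_(i < n) (t i - s i) < d ->
      \sum_(i < n) cabs (g (t i) - g (s i)) < e.

Definition rect (a b c d : R) : set (R * R) := `[a, b] `*` `[c, d].

Definition rect_in_disk (a b c d : R) : Prop :=
  [/\ a < b, c < d & forall q, rect a b c d q -> unit_disk (complex_of_pair q)].

Definition ACL f : Prop := forall a b c d : R, rect_in_disk a b c d ->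
  {ae @lebesgue_measure R, forall y, `[c, d]%classic y ->
     abs_continuous a b (horiz_line f y)} /\
  {ae @lebesgue_measure R, forall x, `[a, b]%classic x ->
     abs_continuous c d (vert_line f x)}.

Definition square_integrable (A : set (R * R)) (u : R * R -> R) : Prop :=
  measurable_fun A u /\ (\int[area]_(q in A) ((u q) ^+ 2)%:E < +oo)%E.

(* Every compact subset of the disk is covered by finitely many such
   rectangles, so this is local square integrability. *)
Definition locally_L2 f : Prop := forall a b c d : R, rect_in_disk a b c d ->
  square_integrable (rect a b c d) (Re \o f \o complex_of_pair) /\
  square_integrable (rect a b c d) (Im \o f \o complex_of_pair).

Definition ACL2 f : Prop := [/\ ACL f, locally_L2 (dx f) & locally_L2 (dy f)].

(* Meaningful for continuously differentiable f only, which is the only case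
   in which it is used. *)
Definition sense_preserving f : Prop :=
  forall z, unit_disk z -> 0 <= wirtinger_jac f z.

Definition elliptic (K K' : R) f : Prop :=
  [/\ sense_preserving f,
      forall z, unit_disk z -> ccontinuous_at f z,
      ACL2 f /\ ae_in unit_disk (fun z => wirtinger_jac f z != 0) &
      ae_in unit_disk
        (fun z => bigLambda f z ^+ 2 <= K * wirtinger_jac f z + K')].

Definition elliptic_harmonic (K K' : R) f : Prop :=
  elliptic K K' f /\ harmonic_mapping f.

Definition poly_elliptic_harmonic (K K' : R) (p : nat)
    (G : nat -> R[i] -> R[i]) (F : R[i] -> R[i]) : Prop :=
  (forall k, (1 <= k <= p)%N -> elliptic_harmonic K K' (G (p - k + 1)%N)) /\
  (forall z, unit_disk z ->
     F z = \sum_(1 <= k < p.+1)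
             `|z| ^+ (2 * (k - 1)) * G (p - k + 1)%N z).

(* L j is Lambda_j, relevant for 1 <= j <= p - 1 only; M is M_p. *)
Definition admissible (K K' : R) (p : nat) (L : nat -> R) (M : R)
    (G : nat -> R[i] -> R[i]) (F : R[i] -> R[i]) : Prop :=
  [/\ poly_elliptic_harmonic K K' p G F,
      F 0 = 0 /\ lambda F 0 = 1,
      forall k, (1 <= k <= p)%N -> G (p - k + 1)%N 0 = 0,
      forall k, (2 <= k <= p)%N -> forall z, unit_disk z ->
        lambda (G (p - k + 1)%N) z <= L (p - k + 1)%N &
      forall z, unit_disk z -> cabs (G p z) <= M].

Definition univalent (A : set R[i]) f : Prop := set_inj A f.

Definition region (A : set R[i]) : Prop :=
  [/\ A !=set0, open (A : set (cplane R)) & connected (A : set (cplane R))].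

Definition has_schlicht_disk f (r : R) w (rho : R) : Prop :=
  0 < rho /\ exists A : set R[i],
    [/\ region A, A `<=` Dr r, univalent A f & f @` A = cdisk w rho].

Definition Lambda' (K K' : R) (L : nat -> R) (j : nat) : R :=
  (K * L j + Num.sqrt (K ^+ 2 * L j ^+ 2 + 4 * K')) / 2.

Definition radius_fun (K K' : R) (p : nat) (L : nat -> R) (M r : R) : R :=
  1 - Num.sqrt (2 * M ^+ 2 - 2) *
        (r * Num.sqrt (r ^+ 4 - 3 * r ^+ 2 + 4) / (1 - r ^+ 2) `^ (3 / 2))
    - \sum_(2 <= k < p.+1)
        (2 * k - 1)%N%:R * Lambda' K K' L (p - k + 1)%N * r ^+ (2 * (k - 1)).

Definition radius_root (K K' : R) (p : nat) (L : nat -> R) (M r : R) : Prop :=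
  0 < r < 1 /\ radius_fun K K' p L M r = 0.

Definition schlicht_radius (K K' : R) (p : nat) (L : nat -> R) (M r : R) : R :=
  r - Num.sqrt (2 * M ^+ 2 - 2) * (r ^+ 2 / Num.sqrt (1 - r ^+ 2))
    - \sum_(2 <= k < p.+1) r ^+ (2 * k - 1) * Lambda' K K' L (p - k + 1)%N.

End plane.

(* Main.v *)
Require Import Defs.
From HB Require Import structures.
From mathcomp Require Import all_boot all_order all_algebra.
From mathcomp Require Import all_classical all_reals all_analysis.
From mathcomp Require Import zify ring lra.
Import Order.TTheory GRing.Theory Num.Theory.
Import numFieldNormedType.Exports.

(** In sqrt(2 M^2 - 2), the degree-one part uses up at least 1 of M^2, and (|a| + |b|)^2 <= 2 (|a|^2
    + |b|^2) doubles what is left. Cauchy-Schwarz against the weights n r^(n-1), n >= 2, gives the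
    other factor in the equation for r_2; against r^n it gives r^2 / sqrt(1 - r^2). Lambda'_j is the
    larger root of x^2 = K Lambda_j x + K': where J >= 0, J is the product of lambda and Lambda, so
    ellipticity is a quadratic inequality for Lambda. It holds only almost everywhere and is spread
    to all points by density and continuity.

    The bound |l h| >= |h| needs lambda = 1 for G_p, while the hypothesis is about F: the other
    summands are O(|z|^3) at 0 and do not change the first derivatives. At r_2 itself the Lipschitz
    constant of the perturbation reaches 1, so every estimate is made at radii r < r_2, and R_2 is
    reached by continuity from the left. *)

(* The linear part l of G_p at 0 satisfies |l h| >= |h|, and F - l has on
   |z| <= r a Lipschitz constant at most 1 - radius_fun(r), so F is a
   contractive perturbation of an expanding real-linear map: it is injective,
   and F z = w is solved by a minimum argument on |z| <= r whenever
   |w| <= schlicht_radius(r).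

   The constant for G_p comes from Parseval's identity
   sum (|a_n|^2 + |b_n|^2) <= M^2 for G_p = sum a_n z^n + conj (b_n z^n), with
   |a_1|^2 + |b_1|^2 >= 1, and the Cauchy-Schwarz inequality.  No power series
   or integral is used: a discrete Cauchy formula approximates the Wirtinger
   derivatives of G_p uniformly by polynomials on |z| <= s < 1, hence G_p by
   harmonic polynomials up to a small Lipschitz constant; Parseval's identity
   for those is an average over roots of unity; at the end s tends to 1.

   For K = 1, K' = 0, M = 1 the extremal map is
   z - sum_k Lambda_{p-k+1} |z|^(2(k-1)) z, whose radial profile has derivative
   radius_fun and is maximal at r_2. *)

Set Implicit Arguments.
Unset Strict Implicit.
Unset Printing Implicit Defensive.

Local Open Scope classical_set_scope.
Local Open Scope ring_scope.
Local Open Scope complex_scope.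

(* Otherwise [^*] below a [\sum] is parsed as the abstract [Num.conj]. *)
Local Notation "x ^*" := (@conjc _ x) : ring_scope.

(** * Complex modulus and compact disks *)

Section cabs.
Context {R : realType}.
Implicit Types (z w : R[i]) (x y : R).
Local Notation Re := (@complex.Re R).
Local Notation Im := (@complex.Im R).

Lemma cabsE z : cabs z = Num.sqrt (Re z ^+ 2 + Im z ^+ 2).
Proof. by case: z. Qed.

Lemma norm_cabs z : `|z| = (cabs z)%:C.
Proof. by case: z. Qed.

Lemma complex_inj : injective (fun x : R => x%:C).
Proof. by move=> x y []. Qed.

Lemma cabs_ge0 z : 0 <= cabs z.
Proof. by rewrite cabsE sqrtr_ge0. Qed.

Lemma sqr_cabs z : cabs z ^+ 2 = Re z ^+ 2 + Im z ^+ 2.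
Proof. by rewrite cabsE sqr_sqrtr// addr_ge0// sqr_ge0. Qed.

Lemma cabs0 : cabs (0 : R[i]) = 0.
Proof. by apply: complex_inj; rewrite -norm_cabs normr0. Qed.

Lemma cabs1 : cabs (1 : R[i]) = 1.
Proof. by apply: complex_inj; rewrite -norm_cabs normr1. Qed.

Lemma cabs_eq0 z : (cabs z == 0) = (z == 0).
Proof.
rewrite -[in RHS]normr_eq0 norm_cabs; apply/eqP/eqP => [->//|].
by move/complex_inj.
Qed.

Lemma cabs_gt0 z : (0 < cabs z) = (z != 0).
Proof. by rewrite lt_def cabs_ge0 andbT cabs_eq0. Qed.

Lemma cabsM z w : cabs (z * w) = cabs z * cabs w.
Proof. by apply: complex_inj; rewrite rmorphM/= -!norm_cabs normrM. Qed.

Lemma cabsX z n : cabs (z ^+ n) = cabs z ^+ n.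
Proof. by elim: n => [|n ih]; rewrite ?expr0 ?cabs1// !exprS cabsM ih. Qed.

Lemma cabsV z : cabs z^-1 = (cabs z)^-1.
Proof. by apply: complex_inj; rewrite fmorphV/= -!norm_cabs normfV. Qed.

Lemma cabsN z : cabs (- z) = cabs z.
Proof. by apply: complex_inj; rewrite -!norm_cabs normrN. Qed.

Lemma cabsBC z w : cabs (z - w) = cabs (w - z).
Proof. by rewrite -cabsN opprB. Qed.

Lemma cabsD z w : cabs (z + w) <= cabs z + cabs w.
Proof. by have := ler_normD z w; rewrite !norm_cabs -rmorphD/= lecR. Qed.

Lemma cabsB z w : cabs (z - w) <= cabs z + cabs w.
Proof. by rewrite -(cabsN w) cabsD. Qed.

Lemma cabs_tri v z w : cabs (z - w) <= cabs (z - v) + cabs (v - w).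
Proof. by rewrite -[z - w](subrKA v) cabsD. Qed.

Lemma ler_cabsB z w : cabs z - cabs w <= cabs (z - w).
Proof. by rewrite lerBlDr; have := cabsD (z - w) w; rewrite subrK. Qed.

Lemma cabs_real x : cabs x%:C = `|x|.
Proof. by rewrite cabsE/= expr0n/= addr0 sqrtr_sqr. Qed.

Lemma cabs_conj z : cabs z^* = cabs z.
Proof. by rewrite !cabsE; case: z => a b /=; rewrite sqrrN. Qed.

Lemma cabs_sum (I : Type) (r : seq I) (P : pred I) (f : I -> R[i]) :
  cabs (\sum_(i <- r | P i) f i) <= \sum_(i <- r | P i) cabs (f i).
Proof.
apply: (big_ind2 (fun z x => cabs z <= x)) => //; first by rewrite cabs0.
move=> z x w y zx wy; exact: le_trans (cabsD _ _) (lerD zx wy).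
Qed.

Lemma Re_le_cabs z : `|Re z| <= cabs z.
Proof. by rewrite cabsE -sqrtr_sqr ler_wsqrtr// lerDl sqr_ge0. Qed.

Lemma Im_le_cabs z : `|Im z| <= cabs z.
Proof. by rewrite cabsE -sqrtr_sqr ler_wsqrtr// lerDr sqr_ge0. Qed.

Lemma cabs_le_ReIm z : cabs z <= `|Re z| + `|Im z|.
Proof.
rewrite -(@ler_pXn2r _ 2) ?nnegrE ?cabs_ge0 ?addr_ge0// sqr_cabs.
rewrite -(real_normK (num_real (Re z))) -(real_normK (num_real (Im z))).
have := normr_ge0 (Re z); have := normr_ge0 (Im z); nra.
Qed.

Lemma ReD z w : Re (z + w) = Re z + Re w. Proof. by case: z w => ? ? []. Qed.
Lemma ImD z w : Im (z + w) = Im z + Im w. Proof. by case: z w => ? ? []. Qed.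
Lemma ReN z : Re (- z) = - Re z. Proof. by case: z. Qed.
Lemma ImN z : Im (- z) = - Im z. Proof. by case: z. Qed.
Lemma ReM z w : Re (z * w) = Re z * Re w - Im z * Im w.
Proof. by case: z w => ? ? []. Qed.
Lemma ImM z w : Im (z * w) = Re z * Im w + Im z * Re w.
Proof. by case: z w => ? ? []. Qed.
Lemma Re_conj z : Re z^* = Re z. Proof. by case: z. Qed.
Lemma Im_conj z : Im z^* = - Im z. Proof. by case: z. Qed.
Definition ReImE := (ReD, ImD, ReN, ImN, ReM, ImM, Re_conj, Im_conj).

Lemma complexP z w : Re z = Re w -> Im z = Im w -> z = w.
Proof. by case: z w => ? ? [? ?] /= -> ->. Qed.

Lemma Re_sqr_cabs z : Re (z^* * z) = cabs z ^+ 2.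
Proof. by rewrite sqr_cabs !ReImE; ring. Qed.

Lemma Re_conjM_le z w : Re (z^* * w) <= cabs z * cabs w.
Proof.
by rewrite -(cabs_conj z) -cabsM (le_trans _ (Re_le_cabs _))// ler_norm.
Qed.

Lemma mul_conjc z : z * z^* = (cabs z ^+ 2)%:C.
Proof. by rewrite sqr_cabs; apply: complexP; rewrite !ReImE/=; ring. Qed.

Lemma cconjD z w : (z + w)^* = z^* + w^*.
Proof. by apply: complexP; rewrite !ReImE ?opprD. Qed.
Lemma cconjB z w : (z - w)^* = z^* - w^*.
Proof. by apply: complexP; rewrite !ReImE//; ring. Qed.
Lemma cconjM z w : (z * w)^* = z^* * w^*.
Proof. by apply: complexP; rewrite !ReImE; ring. Qed.
Lemma cconjX z n : (z ^+ n)^* = z^* ^+ n.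
Proof. by elim: n => [|n ih]; rewrite ?expr0 ?conjc1// !exprS cconjM ih. Qed.
Lemma cconj_sum (I : Type) (r : seq I) (P : pred I) (f : I -> R[i]) :
  (\sum_(i <- r | P i) f i)^* = \sum_(i <- r | P i) (f i)^*.
Proof. by apply: big_morph; [exact: cconjD|exact: conjc0]. Qed.

Lemma realcD x y : (x + y)%:C = x%:C + y%:C.
Proof. exact: rmorphD. Qed.
Lemma realcB x y : (x - y)%:C = x%:C - y%:C.
Proof. exact: rmorphB. Qed.
Lemma realcM x y : (x * y)%:C = x%:C * y%:C.
Proof. exact: rmorphM. Qed.
Lemma realcX x n : (x ^+ n)%:C = x%:C ^+ n.
Proof. exact: rmorphXn. Qed.
Lemma realc_nat n : (n%:R)%:C = n%:R :> R[i].
Proof. exact: rmorph_nat. Qed.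
Lemma realc_sum (I : Type) (r : seq I) (P : pred I) (f : I -> R) :
  (\sum_(i <- r | P i) f i)%:C = \sum_(i <- r | P i) (f i)%:C.
Proof. exact: rmorph_sum. Qed.

Lemma ccontinuousP (f : R[i] -> R[i]) z : ccontinuous_at f z <->
  forall e, 0 < e -> exists2 d, 0 < d &
    forall w, cabs (w - z) < d -> cabs (f w - f z) < e.
Proof.
split.
  move=> fz e e0.
  have e0' : 0 < (e%:C : cplane R) by rewrite ltcR.
  have /(_ _ _ e0') := (iffLR (@cvgrPdist_lt _ (cplane R) (cplane R)
    (nbhs (z : cplane R)) _ (f : cplane R -> cplane R) (f z))) fz.
  move=> /nbhs_ballP[d /= d0 dP].
  have dE : d = (Re d)%:C.
    by move: d0; case: (d) => a b; rewrite ltcE/= => /andP[/eqP -> _].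
  exists (Re d); first by move: d0; rewrite {1}dE ltcR.
  move=> w wd; have := dP w; rewrite /ball/= => /(_ _).
  rewrite distrC norm_cabs dE ltcR => /(_ wd).
  by rewrite distrC norm_cabs ltcR.
move=> H; apply: (iffRL (@cvgrPdist_lt _ (cplane R) (cplane R)
  (nbhs (z : cplane R)) _ (f : cplane R -> cplane R) (f z)) _) => e e0.
have eE : e = (Re e)%:C.
  by move: e0; case: (e) => a b; rewrite ltcE/= => /andP[/eqP -> _].
have [|d d0 dP] := H (Re e); first by move: e0; rewrite eE ltcR.
apply/nbhs_ballP; exists (d%:C : cplane R) => /=; first by rewrite ltcR.
move=> w; rewrite /ball/= distrC norm_cabs ltcR => /dP.
by rewrite distrC norm_cabs eE ltcR.
Qed.

End cabs.

Section compactness.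
Context {R : realType}.
Implicit Types (z w : R[i]) (x y : R).
Local Notation Re := (@complex.Re R).
Local Notation Im := (@complex.Im R).

Lemma cnbhsP z (A : set R[i]) : nbhs (z : cplane R) (A : set (cplane R)) <->
  exists2 d : R, 0 < d & forall w, cabs (w - z) < d -> A w.
Proof.
split.
  move=> /nbhs_ballP[d /= d0 dP].
  have dE : d = (Re d)%:C.
    by move: d0; case: (d) => a b; rewrite ltcE/= => /andP[/eqP -> _].
  exists (Re d); first by move: d0; rewrite {1}dE ltcR.
  by move=> w wd; apply: dP; rewrite /ball/= distrC norm_cabs dE ltcR.
move=> [d d0 dP]; apply/nbhs_ballP; exists (d%:C : cplane R) => /=.
  by rewrite ltcR.
by move=> w; rewrite /ball/= distrC norm_cabs ltcR => /dP.
Qed.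

Lemma complex_of_pair_continuous :
  continuous (complex_of_pair : R * R -> cplane R).
Proof.
move=> q A; move/cnbhsP => [d d0 dA].
have d20 : 0 < d / 2 by rewrite divr_gt0.
apply/nbhs_ballP; exists (d / 2) => //= q' [/= q1 q2].
apply: dA; apply: le_lt_trans (cabs_le_ReIm _) _.
rewrite !ReImE/= distrC [X in _ + X]distrC (splitr d).
exact: ltrD.
Qed.

Lemma cball_compact (r : R) :
  compact ([set z | cabs z <= r] : set (cplane R)).
Proof.
have sqc : compact (`[- r, r]%classic `*` `[- r, r]%classic : set (R * R)).
  by apply: compact_setX; exact: segment_compact.
have {sqc} : compact ((complex_of_pair : R * R -> cplane R) @`
    (`[- r, r]%classic `*` `[- r, r]%classic : set (R * R))).
  apply: continuous_compact => //; apply: continuous_subspaceT.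
  exact: complex_of_pair_continuous.
move=> sqc; apply: (subclosed_compact _ sqc).
  rewrite -openC openE => z /= /negP; rewrite -ltNge => rz.
  apply/cnbhsP; exists (cabs z - r); first by rewrite subr_gt0.
  move=> w wz /=; apply/negP; rewrite -ltNge.
  by have := ler_cabsB z w; rewrite cabsBC; lra.
move=> z /= zr; exists (Re z, Im z) => /=; last by case: z zr.
have := Re_le_cabs z; have := Im_le_cabs z; rewrite !in_itv/= !ler_norml.
by move=> /andP[? ?] /andP[? ?]; split; lra.
Qed.

(** Compactness in its near-covering form, along the filter of small positive [d]. The point [w] may
    leave the closed disk, since continuity is assumed in full neighbourhoods. *)
Lemma cball_unif_continuous (f : R[i] -> R[i]) (r : R) :
  (forall z, cabs z <= r -> ccontinuous_at f z) ->
  forall e, 0 < e -> exists2 d, 0 < d &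
    forall z w, cabs z <= r -> cabs (w - z) < d -> cabs (f w - f z) < e.
Proof.
move=> fc e e0.
have [|d /= d0 H] := iffLR (compact_near_coveringP _) (@cball_compact r)
  R (0 : R)^'+ (fun d z => forall w, cabs (w - z) < d -> cabs (f w - f z) < e).

  move=> z /= zr.
  have [d d0 dP] := (iffLR (ccontinuousP _ _) (fc z zr)) (e / 2)
    ltac:(by rewrite divr_gt0).
  exists ([set w | cabs (w - z) < d / 2], [set x | x < d / 2]).
    split => /=; first by apply/cnbhsP; exists (d / 2) => //; rewrite divr_gt0.
    by apply: nbhs_right_lt; rewrite divr_gt0.
  move=> [w x] [/= wz xd] v vw.
  have := cabs_tri w v z.
  have := cabs_tri (f z) (f v) (f w); rewrite [X in _ <= _ + X]cabsBC => ? ?.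
  by have := dP v ltac:(lra); have := dP w ltac:(lra); lra.
exists (d / 2); first by rewrite divr_gt0.
move=> z w zr wz; apply: (H (d / 2)) => //=.
  by rewrite sub0r normrN gtr0_norm ?divr_gt0//; lra.
by rewrite divr_gt0.
Qed.

Lemma cball_min (f : R[i] -> R[i]) (r : R) : 0 <= r ->
  (forall z, cabs z <= r -> ccontinuous_at f z) ->
  exists2 c, cabs c <= r & forall z, cabs z <= r -> cabs (f c) <= cabs (f z).
Proof.
move=> r0 fc.
have [||c /set_mem cr cP] := @compact_EVT_min (cplane R) R (cabs \o f)
  _ _ (@cball_compact r).
- by exists 0 => /=; rewrite cabs0.
- apply: continuous_in_subspaceT => z /set_mem/= zr.
  apply: (iffRL (@cvgrPdist_lt _ R (cplane R) (nbhs (z : cplane R)) _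
    (cabs \o f) (cabs (f z))) _) => e e0.
  have [d d0 dP] := (iffLR (ccontinuousP _ _) (fc z zr)) e e0.
  apply/cnbhsP; exists d => // w /dP; apply: le_lt_trans => /=.
  rewrite ler_norml; have := ler_cabsB (f w) (f z).
  by have := ler_cabsB (f z) (f w); rewrite cabsBC => ? ?; lra.
by exists c => // z zr; apply: cP; rewrite inE.
Qed.

End compactness.

(** * Curves and plane calculus *)

Section curves.
Context {R : realType}.
Implicit Types (z w : R[i]) (x y t : R) (f g : R -> R[i]).
Local Notation Re := (@complex.Re R).
Local Notation Im := (@complex.Im R).

(** The derivative is an argument, so that the rules of calculus carry existence and value
    together. *)
Definition has_cderiv f t (d : R[i]) :=
  is_derive t (1 : R) (Re \o f : R -> R) (Re d) /\
  is_derive t (1 : R) (Im \o f : R -> R) (Im d).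

(** Writing the error as at most [e * |h|], not as a quotient, lets [h = 0] take part. *)
Lemma is_derive_epsP (u : R -> R) x l : is_derive x (1 : R) u l <->
  forall e, 0 < e -> exists2 d, 0 < d &
    forall h, `|h| < d -> `|u (x + h) - u x - h * l| <= e * `|h|.
Proof.
have key (h e : R) : h != 0 ->
    (`|l - h^-1 *: ((u \o shift x) (h *: 1) - u x)| <= e) =
    (`|u (x + h) - u x - h * l| <= e * `|h|).
  move=> h0; rewrite -ler_pdivrMr ?normr_gt0// -normf_div distrC.
  congr (`| _ | <= _).
  rewrite /= /GRing.scale/= mulr1 (addrC h x); field.
  exact: h0.
split.
  move=> [du ul] e e0.
  have /cvgrPdist_le/(_ _ e0) : h^-1 *: ((u \o shift x) (h *: 1) - u x)
     @[h --> 0^'] --> l by rewrite -ul; exact: du.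
  move=> /nbhs_ballP[d /= d0 dP].
  exists d => // h hd; have [->|h0] := eqVneq h 0.
    by rewrite addr0 !mul0r subrr subr0 normr0 mulr0.
  by rewrite -key//; have := dP h; rewrite /ball/= sub0r normrN => /(_ hd h0).
move=> H.
suff ul2 : h^-1 *: ((u \o shift x) (h *: 1) - u x) @[h --> 0^'] --> l.
  by split; [apply/cvg_ex; exists l; exact: ul2|exact: cvg_lim].
apply/cvgrPdist_le => e e0; have [d d0 dP] := H e e0.
apply/nbhs_ballP; exists d => //= h; rewrite /ball/= sub0r normrN => hd h0.
by rewrite key//; exact: dP.
Qed.

Lemma has_cderiv_epsP f t d : has_cderiv f t d <->
  forall e, 0 < e -> exists2 a : R, 0 < a &
    forall h, `|h| < a -> cabs (f (t + h) - f t - h%:C * d) <= e * `|h|.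
Proof.
split.
  move=> [/is_derive_epsP f1 /is_derive_epsP f2] e e0.
  have [a a0 aP] := f1 (e / 2) ltac:(by rewrite divr_gt0).
  have [b b0 bP] := f2 (e / 2) ltac:(by rewrite divr_gt0).
  exists (Num.min a b); first by rewrite lt_min a0.
  move=> h; rewrite lt_min => /andP[/aP ? /bP ?].
  apply: le_trans (cabs_le_ReIm _) _.
  rewrite !ReImE/= !mul0r subr0 addr0; lra.
move=> H; split; apply/is_derive_epsP => e e0; have [a a0 aP] := H e e0;
  exists a => // h /aP; apply: le_trans.
  by apply: le_trans (Re_le_cabs _); rewrite !ReImE/= !mul0r subr0.
by apply: le_trans (Im_le_cabs _); rewrite !ReImE/= !mul0r addr0.
Qed.

Lemma has_cderiv_cst (c : R[i]) t : has_cderiv (fun=> c) t 0.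
Proof. by split; exact: is_derive_cst. Qed.

Lemma has_cderiv_id t : has_cderiv (fun t => t%:C) t 1.
Proof. by split; [exact: is_derive_id|exact: is_derive_cst]. Qed.

Lemma has_cderivD f g t df dg : has_cderiv f t df -> has_cderiv g t dg ->
  has_cderiv (fun x => f x + g x) t (df + dg).
Proof.
move=> [f1 f2] [g1 g2]; split; rewrite ReImE.
  rewrite (_ : _ \o _ = (Re \o f : R -> R) + (Re \o g : R -> R)).
    exact: is_deriveD.
  by apply/funext => x /=; rewrite ReImE.
rewrite (_ : _ \o _ = (Im \o f : R -> R) + (Im \o g : R -> R)).
  exact: is_deriveD.
by apply/funext => x /=; rewrite ReImE.
Qed.

Lemma has_cderivM f g t df dg : has_cderiv f t df -> has_cderiv g t dg ->
  has_cderiv (fun x => f x * g x) t (df * g t + f t * dg).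
Proof.
move=> [f1 f2] [g1 g2]; split.
  rewrite (_ : _ \o _ = (Re \o f : R -> R) * (Re \o g : R -> R)
                      - (Im \o f : R -> R) * (Im \o g : R -> R)).
    apply: (is_derive_eq (is_deriveB (is_deriveM f1 g1) (is_deriveM f2 g2))).
    by rewrite !ReImE /GRing.scale/=; ring.
  by apply/funext => x /=; rewrite ReImE.
rewrite (_ : _ \o _ = (Re \o f : R -> R) * (Im \o g : R -> R)
                    + (Im \o f : R -> R) * (Re \o g : R -> R)).
  apply: (is_derive_eq (is_deriveD (is_deriveM f1 g2) (is_deriveM f2 g1))).
  by rewrite !ReImE /GRing.scale/=; ring.
by apply/funext => x /=; rewrite ReImE.
Qed.

Lemma has_cderivN f t df : has_cderiv f t df ->
  has_cderiv (fun x => - f x) t (- df).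
Proof.
move=> fd; have := has_cderivM (has_cderiv_cst (-1) t) fd.
by rewrite mul0r add0r mulN1r; under eq_fun do rewrite mulN1r.
Qed.

Lemma has_cderivB f g t df dg : has_cderiv f t df -> has_cderiv g t dg ->
  has_cderiv (fun x => f x - g x) t (df - dg).
Proof. by move=> fd gd; exact: has_cderivD fd (has_cderivN gd). Qed.

Lemma has_cderivMl c f t df : has_cderiv f t df ->
  has_cderiv (fun x => c * f x) t (c * df).
Proof.
by move=> fd; have := has_cderivM (has_cderiv_cst c t) fd; rewrite mul0r add0r.
Qed.

Lemma has_cderiv_conj f t df : has_cderiv f t df ->
  has_cderiv (fun x => (f x)^*) t df^*.
Proof.
move=> [f1 f2]; split; rewrite ReImE.
  rewrite (_ : _ \o _ = (Re \o f : R -> R))//.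
  by apply/funext => x /=; rewrite ReImE.
rewrite (_ : _ \o _ = - (Im \o f : R -> R)); last first.
  by apply/funext => x /=; rewrite ReImE.
exact: is_deriveN.
Qed.

Lemma has_cderiv_sum (I : Type) (r : seq I) (f : I -> R -> R[i])
    (df : I -> R[i]) t : (forall i, has_cderiv (f i) t (df i)) ->
  has_cderiv (fun x => \sum_(i <- r) f i x) t (\sum_(i <- r) df i).
Proof.
move=> fd; elim: r => [|i r ih].
  rewrite big_nil; under eq_fun do rewrite big_nil; exact: has_cderiv_cst.
by rewrite big_cons; under eq_fun do rewrite big_cons; exact: has_cderivD.
Qed.

Lemma has_cderivX f t df n : has_cderiv f t df ->
  has_cderiv (fun x => f x ^+ n.+1) t (n.+1%:R * f t ^+ n * df).
Proof.
move=> fd; elim: n => [|n ih].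
  by rewrite expr0 mulr1 mul1r; under eq_fun do rewrite expr1.
under eq_fun do rewrite exprS.
have := has_cderivM fd ih.
by congr has_cderiv; rewrite -[in RHS]natr1 !exprS; ring.
Qed.

Lemma has_cderiv_affine f a b t d : has_cderiv f (a + b * t) d ->
  has_cderiv (fun x => f (a + b * x)) t (b%:C * d).
Proof.
have ab : is_derive t (1 : R) (fun x => a + b * x) b.
  have : is_derive t (1 : R) (cst a + b *: (id : R -> R)) (0 + b *: (1 : R)).
    exact: is_deriveD.
  by rewrite add0r /GRing.scale/= mulr1.
move=> [f1 f2]; split; rewrite !ReImE/= mul0r ?subr0 ?addr0 mulrC.
  exact: (@is_derive1_comp _ (Re \o f) (fun x => a + b * x)).
exact: (@is_derive1_comp _ (Im \o f) (fun x => a + b * x)).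
Qed.

Lemma has_cderiv_line z h t : has_cderiv (fun x => z + x%:C * h) t h.
Proof.
have := has_cderivD (has_cderiv_cst z t)
  (has_cderivM (has_cderiv_id t) (has_cderiv_cst h t)).
by rewrite mul1r mulr0 add0r addr0.
Qed.

(* Project on the direction of the increment to use the real mean value
   theorem. *)
Lemma cmvt_le g dg (C : R) :
  (forall t, 0 <= t <= 1 -> has_cderiv g t (dg t)) ->
  (forall t, 0 < t < 1 -> cabs (dg t) <= C) ->
  cabs (g 1 - g 0) <= C.
Proof.
move=> gd dgC; set v := g 1 - g 0.
pose u := fun t => Re (v^* * g t).
have ud t : 0 <= t <= 1 -> is_derive t (1 : R) u (Re (v^* * dg t)).
  by move=> /gd /(has_cderivMl v^*) [].
have [||t] := @MVT R u (fun t => Re (v^* * dg t)) 0 1 ltr01.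
- by move=> t; rewrite in_itv/= => /andP[? ?]; apply: ud; rewrite !ltW.
- apply: derivable_within_continuous => t; rewrite in_itv/= => /ud.
  by move=> [].
rewrite in_itv/= subr0 mulr1 => t01.
rewrite /u -ReN -ReD -mulrN -mulrDr -/v Re_sqr_cabs => uE.
have [->|v0] := eqVneq v 0.
  by rewrite cabs0; apply: le_trans (dgC _ t01); exact: cabs_ge0.
rewrite -(@ler_pM2l _ (cabs v)) ?cabs_gt0// -expr2 uE.
apply: le_trans (Re_conjM_le _ _) _.
by rewrite ler_wpM2l ?cabs_ge0// dgC.
Qed.

End curves.

(** * Differential of a plane mapping and symmetry of second derivatives *)

Section plane_calculus.
Context {R : realType}.
Implicit Types (z w h : R[i]) (x y t : R) (f g : R[i] -> R[i]).
Local Notation Re := (@complex.Re R).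
Local Notation Im := (@complex.Im R).
Local Notation I := (0 +i* 1 : R[i]).
Local Notation disk := (@Dr R 1).

Lemma DrE (r : R) z : Dr r z = (cabs z < r).
Proof. by rewrite /Dr /cdisk /= subr0. Qed.

Lemma has_cderivP (g : R -> R[i]) t d :
  has_cderiv g t d <-> cderivable g t /\ cderive g t = d.
Proof.
split=> [[[g1 E1] [g2 E2]]|[[/derivableP g1 /derivableP g2] <-]].
  split; first exact: conj g1 g2.
  by apply: complexP; [rewrite -E1 -derive1E|rewrite -E2 -derive1E].
by rewrite -derive1E in g1; rewrite -derive1E in g2; split.
Qed.

Lemma dx_horiz f z d : has_cderiv (horiz_line f (Im z)) (Re z) d -> dx f z = d.
Proof. by move=> /has_cderivP[]. Qed.

Lemma dy_vert f z d : has_cderiv (vert_line f (Re z)) (Im z) d -> dy f z = d.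
Proof. by move=> /has_cderivP[]. Qed.

Lemma C1_horiz f z : C1_on disk f -> disk z ->
  has_cderiv (horiz_line f (Im z)) (Re z) (dx f z).
Proof. by move=> /[apply] -[? _ _ _]; apply/has_cderivP. Qed.

Lemma C1_vert f z : C1_on disk f -> disk z ->
  has_cderiv (vert_line f (Re z)) (Im z) (dy f z).
Proof. by move=> /[apply] -[_ ? _ _]; apply/has_cderivP. Qed.

Lemma C1_dx_cont f z : C1_on disk f -> disk z -> ccontinuous_at (dx f) z.
Proof. by move=> /[apply] -[]. Qed.

Lemma C1_dy_cont f z : C1_on disk f -> disk z -> ccontinuous_at (dy f) z.
Proof. by move=> /[apply] -[]. Qed.

(** The real-linear Fréchet differential of [f] at [z] applied to [h]; [fdiffE] is its Wirtinger
    form. *)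
Definition fdiff f z h : R[i] := dx f z * (Re h)%:C + dy f z * (Im h)%:C.

Lemma fdiffE f z h : fdiff f z h = dz f z * h + dzbar f z * h^*.
Proof.
have E2 (a : R[i]) : a = (a + a) / 2 by field.
rewrite [LHS]E2 /fdiff /dz /dzbar.
have E (a b u : R[i]) : a * (Re u)%:C + b * (Im u)%:C +
    (a * (Re u)%:C + b * (Im u)%:C) = (a - I * b) * u + (a + I * b) * u^*.
  by apply: complexP; rewrite !ReImE/=; ring.
by rewrite E; ring.
Qed.

Lemma cabs_fdiff f z h : cabs (fdiff f z h) <= bigLambda f z * cabs h.
Proof.
rewrite fdiffE /bigLambda; apply: le_trans (cabsD _ _) _.
by rewrite !cabsM cabs_conj -mulrDl.
Qed.

Lemma disk_nbhs z : disk z -> exists2 d : R, 0 < d &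
  forall w, cabs (w - z) < d -> disk w.
Proof.
rewrite DrE => z1; exists (1 - cabs z); first by rewrite subr_gt0.
by move=> w wz; rewrite DrE; have := ler_cabsB w z; lra.
Qed.

Lemma C1_frechet f z : C1_on disk f -> disk z ->
  forall e, 0 < e -> exists2 d, 0 < d & forall h, cabs h < d ->
    cabs (f (z + h) - f z - fdiff f z h) <= e * cabs h.
Proof.
move=> fC1 zD e e0; have e20 : 0 < e / 2 by rewrite divr_gt0.
have [d0 d00 d0P] := disk_nbhs zD.
have [d1 d10 d1P] := iffLR (ccontinuousP _ _) (C1_dx_cont fC1 zD) _ e20.
have [d2 d20 d2P] := iffLR (ccontinuousP _ _) (C1_dy_cont fC1 zD) _ e20.
exists (Num.min d0 (Num.min d1 d2)); first by rewrite !lt_min d00 d10.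
move=> h; rewrite !lt_min => /and3P[hd0 hd1 hd2].
(* Go from [z] to [z + h] horizontally along [p], then vertically along [q]; both legs stay within
   |h| of [z], where the partial derivatives are nearly constant. *)
pose p t := (Re z + Re h * t) +i* Im z.
pose q t := (Re z + Re h) +i* (Im z + Im h * t).
have pz t : 0 <= t <= 1 -> cabs (p t - z) <= cabs h.
  move=> /andP[t0 t1]; rewrite -(@ler_pXn2r _ 2) ?nnegrE ?cabs_ge0// !sqr_cabs.
  rewrite !ReImE/= (_ : _ - _ = Re h * t); last by ring.
  rewrite subrr expr0n/= addr0 exprMn.
  have := sqr_ge0 (Re h); have := sqr_ge0 (Im h).
  have : t ^+ 2 <= 1 by rewrite expr_le1.
  have := sqr_ge0 t; nra.
have qz t : 0 <= t <= 1 -> cabs (q t - z) <= cabs h.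
  move=> /andP[t0 t1]; rewrite -(@ler_pXn2r _ 2) ?nnegrE ?cabs_ge0// !sqr_cabs.
  rewrite !ReImE/= (_ : _ - Re z = Re h); last by ring.
  rewrite (_ : _ - Im z = Im h * t); last by ring.
  rewrite exprMn lerD2l.
  have := sqr_ge0 (Im h); have : t ^+ 2 <= 1 by rewrite expr_le1.
  have := sqr_ge0 t; nra.
have -> : f (z + h) - f z - fdiff f z h =
    (f (p 1) - dx f z * (Re h)%:C * 1%:C -
     (f (p 0) - dx f z * (Re h)%:C * 0%:C))
  + (f (q 1) - dy f z * (Im h)%:C * 1%:C -
     (f (q 0) - dy f z * (Im h)%:C * 0%:C)).
  have -> : p 1 = q 0 by apply: complexP; rewrite /= ?mulr1 ?mulr0 ?addr0.
  have -> : p 0 = z by apply: complexP; rewrite /= ?mulr0 ?addr0.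
  have -> : q 1 = z + h by apply: complexP; rewrite !ReImE /= ?mulr1.
  by rewrite /fdiff !mulr0 !mulr1; ring.
rewrite (splitr e) mulrDl; apply: le_trans (cabsD _ _) _; apply: lerD.
  apply: (@cmvt_le _ (fun t => f (p t) - dx f z * (Re h)%:C * t%:C)
     (fun t => (Re h)%:C * dx f (p t) - dx f z * (Re h)%:C * 1)).
    move=> t t01; apply: has_cderivB; last first.
      exact: has_cderivMl (has_cderiv_id _).
    apply: (@has_cderiv_affine _ (horiz_line f (Im z))).
    apply: (@C1_horiz f (p t)) => //; apply: d0P.
    exact: le_lt_trans (pz _ t01) _.
  move=> t t01; rewrite mulr1 mulrC -mulrBl cabsM cabs_real.
  apply: ler_pM; rewrite ?cabs_ge0 ?normr_ge0 ?Re_le_cabs//.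
  apply/ltW/d1P; apply: le_lt_trans (pz _ _) hd1.
  by case/andP: t01 => *; rewrite !ltW.
apply: (@cmvt_le _ (fun t => f (q t) - dy f z * (Im h)%:C * t%:C)
   (fun t => (Im h)%:C * dy f (q t) - dy f z * (Im h)%:C * 1)).
  move=> t t01; apply: has_cderivB; last first.
    exact: has_cderivMl (has_cderiv_id _).
  apply: (@has_cderiv_affine _ (vert_line f (Re z + Re h))).
  apply: (@C1_vert f (q t)) => //; apply: d0P.
  exact: le_lt_trans (qz _ t01) _.
move=> t t01; rewrite mulr1 mulrC -mulrBl cabsM cabs_real.
apply: ler_pM; rewrite ?cabs_ge0 ?normr_ge0 ?Im_le_cabs//.
apply/ltW/d2P; apply: le_lt_trans (qz _ _) hd2.
by case/andP: t01 => *; rewrite !ltW.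
Qed.

Lemma fdiffZ f z h (a : R) : fdiff f z (a%:C * h) = a%:C * fdiff f z h.
Proof.
rewrite /fdiff !ReImE/= !mul0r subr0 addr0 !realcM; ring.
Qed.

Lemma fdiff_real f z (a : R) : fdiff f z a%:C = a%:C * dx f z.
Proof. by rewrite /fdiff /= mulr0 addr0 mulrC. Qed.

Lemma fdiff_imag f z (a : R) : fdiff f z (I * a%:C) = a%:C * dy f z.
Proof.
by rewrite /fdiff !ReImE/= !mul0r !mul1r subr0 mulr0 !add0r mulrC.
Qed.

Lemma C1_line f z h t : C1_on disk f -> disk (z + t%:C * h) ->
  has_cderiv (fun x => f (z + x%:C * h)) t (fdiff f (z + t%:C * h) h).
Proof.
move=> fC1 zD; apply/has_cderiv_epsP => e e0.
have h1 : 0 < cabs h + 1 by rewrite ltr_wpDl ?cabs_ge0.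
have [|d d0 dP] := C1_frechet fC1 zD (e := e / (cabs h + 1)).
  by rewrite divr_gt0.
exists (d / (cabs h + 1)); first by rewrite divr_gt0.
move=> k; rewrite ltr_pdivlMr// => kd.
have := dP (k%:C * h); rewrite cabsM cabs_real.
have -> : z + (t + k)%:C * h = z + t%:C * h + k%:C * h.
  by rewrite realcD; ring.
have kh : `|k| * cabs h <= `|k| * (cabs h + 1).
  by rewrite ler_wpM2l// lerDl.
rewrite fdiffZ => /(_ (le_lt_trans kh kd)) /le_trans; apply.
rewrite mulrAC ler_pdivrMr// -mulrA ler_wpM2l// ltW//.
Qed.

Lemma C1_continuous f z : C1_on disk f -> disk z -> ccontinuous_at f z.
Proof.
move=> fC1 zD; apply/ccontinuousP => e e0.
have [d d0 dP] := C1_frechet fC1 zD ltr01.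
have [D D0 DP] : exists2 D, 0 < D & forall h, cabs (fdiff f z h) <= D * cabs h.
  exists (bigLambda f z + 1).
    by rewrite ltr_wpDl// addr_ge0// cabs_ge0.
  move=> h; apply: le_trans (cabs_fdiff _ _ _) _.
  by rewrite ler_wpM2r ?cabs_ge0// lerDl.
have D1 : 0 < D + 1 by rewrite addr_gt0.
exists (Num.min d (e / (D + 1))).
  by rewrite lt_min d0 divr_gt0.
move=> w; rewrite lt_min ltr_pdivlMr// => /andP[/dP wd we].
move: wd; rewrite subrKC mul1r => wd.
have := ler_cabsB (f w - f z) (fdiff f z (w - z)); have := DP (w - z).
lra.
Qed.

Lemma disk_segment z h t (s : R) : cabs z < s -> cabs (z + h) < s ->
  0 <= t <= 1 -> cabs (z + t%:C * h) < s.
Proof.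
move=> zs zhs /andP[t0]; rewrite le_eqVlt => /predU1P[->|t1].
  by rewrite mul1r.
have -> : z + t%:C * h = (1 - t)%:C * z + t%:C * (z + h).
  by rewrite realcB; ring.
have t1' : 0 < 1 - t by rewrite subr_gt0.
apply: le_lt_trans (cabsD _ _) _.
rewrite !cabsM !cabs_real (ger0_norm t0) (gtr0_norm t1').
rewrite -[ltRHS]mul1r -[in ltRHS](subrK t 1) [ltRHS]mulrDl.
rewrite ltr_leD// ?ltr_pM2l//.
by rewrite ler_wpM2l// ltW.
Qed.

Lemma cball_segment z h t (s : R) : cabs z <= s -> cabs (z + h) <= s ->
  0 <= t <= 1 -> cabs (z + t%:C * h) <= s.
Proof.
move=> zs zhs /andP[t0 t1].
have -> : z + t%:C * h = (1 - t)%:C * z + t%:C * (z + h).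
  by rewrite realcB; ring.
apply: le_trans (cabsD _ _) _; rewrite !cabsM !cabs_real !ger0_norm ?subr_ge0//.
nra.
Qed.

Lemma C2_schwarz f z : C2_on disk f -> disk z -> dx (dy f) z = dy (dx f) z.
Proof.
move=> [fC1 fxC1 fyC1] zD; apply/eqP; rewrite -subr_eq0 -cabs_eq0.
rewrite eq_le cabs_ge0 andbT; apply/ler_addgt0Pl => e e0; rewrite addr0.
have e20 : 0 < e / 2 by rewrite divr_gt0.
have [d0 d00 d0P] := disk_nbhs zD.
have [d1 d10 d1P] := iffLR (ccontinuousP _ _) (C1_dx_cont fyC1 zD) _ e20.
have [d2 d20 d2P] := iffLR (ccontinuousP _ _) (C1_dy_cont fxC1 zD) _ e20.
have [a a0 /and3P[ad0 ad1 ad2]] :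
    exists2 a : R, 0 < a & [&& 2 * a < d0, 2 * a < d1 & 2 * a < d2].
  have : 0 < Num.min d0 (Num.min d1 d2) by rewrite !lt_min d00 d10.
  by exists (Num.min d0 (Num.min d1 d2) / 3); rewrite -?lt_min; lra.
pose p s t := z + (s * a)%:C + I * (t * a)%:C.
have pz s t : 0 <= s <= 1 -> 0 <= t <= 1 -> cabs (p s t - z) <= 2 * a.
  move=> /andP[s0 s1] /andP[t0 t1]; apply: le_trans (cabs_le_ReIm _) _.
  rewrite !ReImE/= !ger0_norm; nra.
pose D := dy (dx f) z; pose E := dx (dy f) z.
(* The second difference over a square of side [a]. Taking differences in one order compares it with
   [a * a] times [D], in the other with [a * a] times [E]. *)
pose S := f (p 1 1) - f (p 1 0) - f (p 0 1) + f (p 0 0).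
have pDx s t : 0 <= s <= 1 -> 0 <= t <= 1 -> forall g, C1_on disk g ->
    has_cderiv (fun s => g (p s t)) s (a%:C * dx g (p s t)).
  move=> s01 t01 g gC1.
  have pE s' : p s' t = z + I * (t * a)%:C + s'%:C * a%:C.
    by rewrite /p realcM; ring.
  have := @C1_line g (z + I * (t * a)%:C) a%:C s gC1.
  rewrite fdiff_real -pE; under eq_fun do rewrite -pE; apply.
  by apply: d0P; apply: le_lt_trans (pz _ _ _ _) ad0.
have pDy s t : 0 <= s <= 1 -> 0 <= t <= 1 -> forall g, C1_on disk g ->
    has_cderiv (fun t => g (p s t)) t (a%:C * dy g (p s t)).
  move=> s01 t01 g gC1.
  have pE t' : p s t' = z + (s * a)%:C + t'%:C * (I * a%:C).
    by rewrite /p !realcM; ring.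
  have := @C1_line g (z + (s * a)%:C) (I * a%:C) t gC1.
  rewrite fdiff_imag -pE.
  under eq_fun do rewrite -pE; apply.
  by apply: d0P; apply: le_lt_trans (pz _ _ _ _) ad0.
have I0 : 0 <= (0 : R) <= 1 by rewrite lexx ler01.
have I1 : 0 <= (1 : R) <= 1 by rewrite lexx ler01.
have Io (s : R) : 0 < s < 1 -> 0 <= s <= 1 by move=> /andP[? ?]; rewrite !ltW.
have SD : cabs (S - (a * a)%:C * D) <= a * (a * (e / 2)).
  have -> : S - (a * a)%:C * D =
      (f (p 1 1) - f (p 1 0) - (a * a)%:C * D * 1%:C)
      - (f (p 0 1) - f (p 0 0) - (a * a)%:C * D * 0%:C).
    by rewrite /S mulr0 mulr1; ring.
  apply: (@cmvt_le _ (fun s => f (p s 1) - f (p s 0) - (a * a)%:C * D * s%:C)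
    (fun s => a%:C * dx f (p s 1) - a%:C * dx f (p s 0) - (a * a)%:C * D * 1)).
    move=> s s01; apply: has_cderivB; first by apply: has_cderivB; apply: pDx.
    exact: has_cderivMl (has_cderiv_id _).
  move=> s /Io s01; rewrite [X in cabs X](_ : _ =
    a%:C * (dx f (p s 1) - dx f (p s 0) - a%:C * D)); last first.
    by rewrite realcM; ring.
  rewrite cabsM cabs_real.
  rewrite ger0_norm ?(ltW a0)// ler_wpM2l ?(ltW a0)//.
  have -> : dx f (p s 1) - dx f (p s 0) - a%:C * D =
      (dx f (p s 1) - a%:C * D * 1%:C) - (dx f (p s 0) - a%:C * D * 0%:C).
    by rewrite mulr0 mulr1; ring.
  apply: (@cmvt_le _ (fun t => dx f (p s t) - a%:C * D * t%:C)
    (fun t => a%:C * dy (dx f) (p s t) - a%:C * D * 1)).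
    move=> t t01; apply: has_cderivB; first exact: pDy.
    exact: has_cderivMl (has_cderiv_id _).
  move=> t /Io t01; rewrite mulr1 -!mulrBr cabsM cabs_real.
  rewrite ger0_norm ?(ltW a0)// ler_wpM2l ?(ltW a0)//.
  by apply/ltW/d2P; apply: le_lt_trans (pz _ _ _ _) ad2.
have SE : cabs (S - (a * a)%:C * E) <= a * (a * (e / 2)).
  have -> : S - (a * a)%:C * E =
      (f (p 1 1) - f (p 0 1) - (a * a)%:C * E * 1%:C)
      - (f (p 1 0) - f (p 0 0) - (a * a)%:C * E * 0%:C).
    by rewrite /S mulr0 mulr1; ring.
  apply: (@cmvt_le _ (fun t => f (p 1 t) - f (p 0 t) - (a * a)%:C * E * t%:C)
    (fun t => a%:C * dy f (p 1 t) - a%:C * dy f (p 0 t) - (a * a)%:C * E * 1)).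
    move=> t t01; apply: has_cderivB; first by apply: has_cderivB; apply: pDy.
    exact: has_cderivMl (has_cderiv_id _).
  move=> t /Io t01; rewrite [X in cabs X](_ : _ =
    a%:C * (dy f (p 1 t) - dy f (p 0 t) - a%:C * E)); last first.
    by rewrite realcM; ring.
  rewrite cabsM cabs_real.
  rewrite ger0_norm ?(ltW a0)// ler_wpM2l ?(ltW a0)//.
  have -> : dy f (p 1 t) - dy f (p 0 t) - a%:C * E =
      (dy f (p 1 t) - a%:C * E * 1%:C) - (dy f (p 0 t) - a%:C * E * 0%:C).
    by rewrite mulr0 mulr1; ring.
  apply: (@cmvt_le _ (fun s => dy f (p s t) - a%:C * E * s%:C)
    (fun s => a%:C * dx (dy f) (p s t) - a%:C * E * 1)).
    move=> s s01; apply: has_cderivB; first exact: pDx.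
    exact: has_cderivMl (has_cderiv_id _).
  move=> s /Io s01; rewrite mulr1 -!mulrBr cabsM cabs_real.
  rewrite ger0_norm ?(ltW a0)// ler_wpM2l ?(ltW a0)//.
  by apply/ltW/d1P; apply: le_lt_trans (pz _ _ _ _) ad1.
have aa0 : 0 < a * a by rewrite mulr_gt0.
rewrite -(ler_pM2l aa0) -[a * a in leLHS]gtr0_norm// -cabs_real -cabsM.
have -> : (a * a)%:C * (dx (dy f) z - dy (dx f) z) =
    (S - (a * a)%:C * D) - (S - (a * a)%:C * E) by rewrite /D /E; ring.
apply: le_trans (cabsB _ _) (le_trans (lerD SD SE) _).
by rewrite (_ : _ + _ = a * a * e)//; field.
Qed.

End plane_calculus.

(** * Discrete Cauchy formula *)

Section roots_of_unity.
Context {R : realType}.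
Local Notation Re := (@complex.Re R).
Local Notation Im := (@complex.Im R).

Definition cis (t : R) : R[i] := cos t +i* sin t.

Lemma cisX t n : cis t ^+ n = cis (n%:R * t).
Proof.
elim: n => [|n ih]; first by rewrite expr0 mul0r /cis cos0 sin0.
rewrite exprS ih -natr1 mulrDl mul1r addrC /cis cosD sinD.
by apply: complexP; rewrite !ReImE/=; ring.
Qed.

Lemma cabs_cis t : cabs (cis t) = 1.
Proof.
apply/eqP; rewrite -(@eqrXn2 _ 2) ?cabs_ge0// expr1n.
by rewrite sqr_cabs/= cos2Dsin2.
Qed.

Lemma cis_prim_root n : n.+1.-primitive_root (cis (2 * pi / n.+1%:R)).
Proof.
apply/andP; split=> //; apply/forallP => -[m /= mn]; rewrite unity_rootE cisX.
apply/eqP; rewrite eqSS; move: mn; rewrite ltnS leq_eqVlt => /predU1P[->|mn].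
  rewrite eqxx mulrC mulfVK ?pnatr_eq0//.
  have -> : 2 * pi = pi *+ 2 :> R by rewrite mulr_natl.
  by rewrite /cis cos2pi sin2pi; apply/eqP.
rewrite (ltn_eqF mn); apply/eqP => -[/eqP+ _]; apply/negP.
(* A power equal to 1 would give [cos (x *+ 2) = 1], against [0 < sin x]. *)
set x := m.+1%:R * pi / n.+1%:R : R.
have x0 : 0 < sin x.
  apply: sin_gt0_pi; rewrite /x divr_gt0 ?mulr_gt0 ?ltr0n ?pi_gt0//=.
  by rewrite ltr_pdivrMr ?ltr0n// mulrC ltr_pM2l ?pi_gt0// ltr_nat.
rewrite (_ : _ * _ = x *+ 2); last by rewrite /x -mulr_natl; ring.
have := exprn_gt0 2 x0; have := cos2Dsin2 x.
by rewrite cos_mulr2n -mulr_natl => ? ?; rewrite lt_eqF//; lra.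
Qed.

(** Consecutive powers of such a root are close, which keeps the telescoping steps in
    [holo_poly_approx0] short; [1 < n] rules out the root 1. *)
Lemma exists_prim_root_near1 (d : R) : 0 < d ->
  exists n (w : R[i]), [/\ (1 < n)%N, n.-primitive_root w, cabs w = 1 &
    cabs (w - 1) < d].
Proof.
move=> d0.
have [a a0 aP] : exists2 a : R, 0 < a &
    forall t, `|t| < a -> `|cos t - 1| < d / 2 /\ `|sin t| < d / 2.
  have c := @continuous_cos R 0; have s := @continuous_sin R 0.
  have d20 : 0 < d / 2 by rewrite divr_gt0.
  move/cvgrPdist_lt: c => /(_ _ d20)/nbhs_ballP[a /= a0 aP].
  move/cvgrPdist_lt: s => /(_ _ d20)/nbhs_ballP[b /= b0 bP].
  exists (Num.min a b); first by rewrite lt_min a0.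
  move=> t; rewrite lt_min => /andP[ta tb].
  have := aP t; rewrite /ball/= sub0r normrN cos0 distrC => /(_ ta) ?.
  have := bP t; rewrite /ball/= sub0r normrN sin0 sub0r normrN => /(_ tb) ?.
  by split.
have pi0 := pi_gt0 R.
pose n := (Num.truncn (2 * pi / a)).+1.
exists n.+1, (cis (2 * pi / n.+1%:R)); split=> //.
- exact: cis_prim_root.
- exact: cabs_cis.
apply: le_lt_trans (cabs_le_ReIm _) _; rewrite !ReImE/= subr0.
have [] := aP (2 * pi / n.+1%:R); last by lra.
rewrite ger0_norm ?divr_ge0 ?mulr_ge0 ?(ltW pi0)//.
rewrite ltr_pdivrMr ?ltr0n// [ltRHS]mulrC -ltr_pdivrMr//.
by apply: lt_trans (truncnS_gt _) _; rewrite ltr_nat.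
Qed.

Lemma sum_prim_root n (w : R[i]) k : n.-primitive_root w -> (0 < k < n)%N ->
  \sum_(j < n) (w ^+ j) ^+ k = 0.
Proof.
move=> wn /andP[k0 kn].
have : (w ^+ k - 1) * (\sum_(j < n) (w ^+ k) ^+ j) = 0.
  by rewrite -subrX1 exprAC (prim_expr_order wn) expr1n subrr.
move/eqP; rewrite mulf_eq0 subr_eq0 -(prim_order_dvd wn) gtnNdvd//= => /eqP.
by under eq_bigr do rewrite exprAC.
Qed.

Lemma sum_prim_rootV n (w : R[i]) k : n.-primitive_root w -> (0 < k < n)%N ->
  \sum_(j < n) (w ^+ j) ^- k = 0.
Proof.
move=> wn /andP[k0 kn].
have : (w ^- k - 1) * (\sum_(j < n) (w ^- k) ^+ j) = 0.
  rewrite -subrX1 -exprVn exprAC exprVn (prim_expr_order wn).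
  by rewrite invr1 expr1n subrr.
move/eqP; rewrite mulf_eq0 subr_eq0 invr_eq1 -(prim_order_dvd wn) gtnNdvd//=.
by move=> /eqP; under eq_bigr do rewrite exprVn exprAC.
Qed.

End roots_of_unity.

(** * Polynomial approximation of holomorphic functions *)

Section cauchy.
Context {R : realType}.
Implicit Types (z w h : R[i]) (x y t : R) (f g : R[i] -> R[i]).
Local Notation Re := (@complex.Re R).
Local Notation Im := (@complex.Im R).
Local Notation I := (0 +i* 1 : R[i]).
Local Notation disk := (@Dr R 1).

Definition holomorphic f : Prop :=
  C1_on disk f /\ forall z, disk z -> dy f z = I * dx f z.

Lemma holo_fdiff f z h : holomorphic f -> disk z -> fdiff f z h = dx f z * h.
Proof.
move=> [_ fI] zD; rewrite /fdiff fI//.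
by case: h => a b /=; apply: complexP; rewrite !ReImE/=; ring.
Qed.

Lemma le_disk z s : cabs z <= s -> s < 1 -> disk z.
Proof. by rewrite DrE; exact: le_lt_trans. Qed.

(** Uniformity in [z] lets a single root of unity serve for all the point families of
    [holo_poly_approx0]. *)
Lemma holo_unif_diff f (s e : R) : holomorphic f -> s < 1 -> 0 < e ->
  exists2 d, 0 < d & forall z w, cabs z <= s -> cabs w <= s ->
    cabs (w - z) < d -> cabs (f w - f z - dx f z * (w - z)) <= e * cabs (w - z).
Proof.
move=> fH s1 e0.
have [|d d0 dP] := @cball_unif_continuous _ (dx f) s _ e e0.
  by move=> z zs; apply: C1_dx_cont fH.1 (le_disk zs s1).
exists d => // z w zs ws wzd.
have seg t : 0 <= t <= 1 -> cabs (z + t%:C * (w - z)) <= s.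
  by apply: cball_segment; rewrite // subrKC.
have -> : f w - f z - dx f z * (w - z) =
   (f (z + 1%:C * (w - z)) - dx f z * (w - z) * 1%:C) -
   (f (z + 0%:C * (w - z)) - dx f z * (w - z) * 0%:C).
  rewrite !mulr0 !mulr1 mul1r mul0r addr0 subrKC; ring.
apply: (@cmvt_le _ (fun t => f (z + t%:C * (w - z)) - dx f z * (w - z) * t%:C)
  (fun t => dx f (z + t%:C * (w - z)) * (w - z) - dx f z * (w - z) * 1)).
  move=> t t01; apply: has_cderivB.
    have zD := le_disk (seg t t01) s1.
    by rewrite -(holo_fdiff _ fH zD); apply: C1_line => //; exact: fH.1.
  exact: has_cderivMl (has_cderiv_id _).
move=> t /andP[t0 t1]; rewrite mulr1 -mulrBl cabsM ler_wpM2r ?cabs_ge0//.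
apply/ltW/dP => //; rewrite addrC addKr cabsM cabs_real ger0_norm ?ltW//.
by apply: le_lt_trans wzd; rewrite ler_piMl ?cabs_ge0// ltW.
Qed.

(* Discrete form of Cauchy's formula: the polynomial interpolates [f] at the
   points [s * w ^+ j], and the average of [f'] over the points
   [z + t (s * w ^+ j - z)], weighted by [w ^+ j], is nearly a telescoping
   sum, hence small. *)
Lemma holo_poly_approx0 f (s e : R) : holomorphic f -> 0 < s < 1 -> 0 < e ->
  exists n (c : nat -> R[i]), forall z, cabs z <= s ->
    cabs (f z - \sum_(k < n) c k * z ^+ k) <= e.
Proof.
move=> fH /andP[s0 s1] e0.
have e20 : 0 < e / 2 by rewrite divr_gt0.
have [d d0 dP] := holo_unif_diff fH s1 e20.
have [n [w [n1 wn w1 wd]]] := exists_prim_root_near1 d0.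
have n0 : (0 < n)%N := ltnW n1.
have w0 : w != 0 by rewrite -cabs_gt0 w1.
have nn0 : n%:R != 0 :> R[i] by rewrite pnatr_eq0 -lt0n.
have sC0 : s%:C != 0 :> R[i].
  by rewrite -cabs_gt0 cabs_real normr_gt0 gt_eqF.
pose zt j := s%:C * w ^+ j.
have zt0 j : zt j != 0 by rewrite mulf_neq0// expf_neq0.
have czt j : cabs (zt j) = s.
  by rewrite cabsM cabs_real cabsX w1 expr1n mulr1 gtr0_norm.
exists n, (fun k => n%:R^-1 * \sum_(j < n) f (zt j) * zt j ^- k) => z zs.
pose gm t j := z + t%:C * (zt j - z).
(* The truncated Cauchy kernel zt_j / (zt_j - z). By [WE], its product with [zt j - z] is [zt j]
   times a factor that is the same for all [j] and so leaves the sum in [gD]. *)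
pose W j := \sum_(k < n) (z / zt j) ^+ k.
have gms t j : 0 <= t <= 1 -> cabs (gm t j) <= s.
  by apply: cball_segment => //; rewrite subrKC czt.
pose q := z / s%:C.
have q1 : cabs (1 - q ^+ n) <= 2.
  apply: le_trans (cabsB _ _) _; rewrite cabs1 cabsX /q cabsM cabsV cabs_real.
  rewrite gtr0_norm// (_ : 2 = 1 + 1)// lerD2l exprn_ile1//.
    by rewrite divr_ge0 ?cabs_ge0// ltW.
  by rewrite ler_pdivrMr// mul1r.
have WE j : (zt j - z) * W j = zt j * (1 - q ^+ n).
  have -> : zt j - z = - zt j * (z / zt j - 1) by field; exact: zt0.
  rewrite -mulrA /W -subrX1 exprMn exprVn /zt exprMn exprAC.
  by rewrite (prim_expr_order wn) expr1n mulr1 /q exprMn exprVn; ring.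
have ztS j : gm^~ j.+1 = fun t => gm t j + t%:C * zt j * (w - 1).
  by apply/funext => t; rewrite /gm /zt exprS; ring.
have gmn t : gm t n = gm t 0%N by rewrite /gm /zt (prim_expr_order wn) expr0.
(* A homotopy: at [t = 0] all points are [z] and only the [k = 0] part of the kernel survives
   summation, giving n f(z); at [t = 1] it is n times the polynomial. It remains to bound its
   derivative. *)
pose g t := \sum_(j < n) W j * f (gm t j).
have gD t : 0 <= t <= 1 -> has_cderiv g t
    ((1 - q ^+ n) * \sum_(j < n) dx f (gm t j) * zt j).
  move=> t01; rewrite mulr_sumr.
  rewrite (_ : \sum_(j < n) _ =
     \sum_(j < n) W j * (dx f (gm t j) * (zt j - z))); last first.
    by apply: eq_bigr => j _; rewrite mulrCA -[RHS]mulrC -mulrA WE; ring.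
  apply: has_cderiv_sum => j; apply: has_cderivMl.
  have zD := le_disk (gms t j t01) s1.
  by rewrite -(holo_fdiff _ fH zD); apply: C1_line => //; exact: fH.1.
have gb t : 0 < t < 1 ->
    cabs ((1 - q ^+ n) * \sum_(j < n) dx f (gm t j) * zt j) <= n%:R * e.
  move=> /andP[t0 t1]; set T := \sum_(j < n) _.
  have t01 : 0 <= t <= 1 by rewrite !ltW.
  have w10 : 0 < cabs (w - 1).
    rewrite cabs_gt0 subr_eq0 -(expr1 w) -(prim_order_dvd wn) dvdn1.
    by rewrite gtn_eqF.
  have tw : 0 < t * cabs (w - 1) by rewrite mulr_gt0.
  have stepE j : gm t j.+1 - gm t j = t%:C * zt j * (w - 1).
    by rewrite (congr1 (fun F => F t) (ztS j)) addrC addKr.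
  have stepC j : cabs (gm t j.+1 - gm t j) = t * s * cabs (w - 1).
    by rewrite stepE 2!cabsM cabs_real gtr0_norm// czt.
  have tel : \sum_(j < n) (f (gm t j.+1) - f (gm t j)) = 0.
    rewrite -(big_mkord xpredT (fun j => f (gm t j.+1) - f (gm t j))).
    by rewrite telescope_sumr// gmn subrr.
  (* The increments of [f] add up to 0 because the points close up, so only linearisation errors
     remain. Each is at most [e / 2] times a step of length [t * s * |w - 1|], and the factor
     [t * |w - 1|] cancels. *)
  have TE : t%:C * (w - 1) * T = - \sum_(j < n)
      (f (gm t j.+1) - f (gm t j) - dx f (gm t j) * (gm t j.+1 - gm t j)).
    rewrite sumrB tel sub0r opprK mulr_sumr; apply: eq_bigr => j _.
    by rewrite stepE; ring.
  have Tb : cabs T <= n%:R * (e / 2).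
    rewrite -(ler_pM2l tw) -{1}(gtr0_norm t0) -cabs_real -!cabsM TE cabsN.
    apply: le_trans (cabs_sum _ _ _) _.
    rewrite mulrCA mulr_natl -[n in _ *+ n]card_ord -sumr_const.
    apply: ler_sum => j _.
    have := dP (gm t j) (gm t j.+1) (gms _ _ t01) (gms _ _ t01).
    rewrite stepC => /(_ _)/le_trans; apply.
      apply: le_lt_trans wd; rewrite ler_piMl ?cabs_ge0//.
      by rewrite mulr_ile1// ltW.
    rewrite mulrC; rewrite ler_wpM2r// ?(ltW e20)// ler_wpM2r ?cabs_ge0//.
    by rewrite ler_piMr// ltW.
  rewrite cabsM; apply: le_trans (ler_pM _ _ q1 Tb) _; rewrite ?cabs_ge0//.
  by rewrite (_ : 2 * _ = n%:R * e)//; field.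
have g0 : g 0 = n%:R * f z.
  rewrite /g; under eq_bigr do rewrite /gm mul0r addr0.
  rewrite -mulr_suml; congr (_ * _); rewrite /W exchange_big/=.
  rewrite (bigD1 (Ordinal n0))//= [X in _ + X]big1 ?addr0; last first.
    move=> k k0; under eq_bigr do rewrite /zt invfM mulrA exprMn exprVn.
    rewrite -mulr_sumr sum_prim_rootV ?mulr0// ltn_ord andbT.
    by move: k0; rewrite -val_eqE/= lt0n.
  by under eq_bigr do rewrite expr0; rewrite sumr_const card_ord.
have g1 : g 1 = n%:R *
    \sum_(k < n) n%:R^-1 * (\sum_(j < n) f (zt j) * zt j ^- k) * z ^+ k.
  under [in RHS]eq_bigr do rewrite -mulrA.
  rewrite -mulr_sumr mulVKf// /g.
  under [RHS]eq_bigr do rewrite mulr_suml.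
  rewrite exchange_big/=; apply: eq_bigr => j _.
  rewrite /gm mul1r subrKC /W mulr_suml; apply: eq_bigr => k _.
  by rewrite exprMn exprVn; ring.
have := cmvt_le gD gb; rewrite g0 g1 -mulrBr cabsM cabsBC.
by rewrite -realc_nat cabs_real ger0_norm ?ler0n// ler_pM2l ?ltr0n.
Qed.

(** The constant term must be exact: for the Wirtinger derivatives it becomes the degree-one
    coefficient that enters Parseval's identity. Replacing [c 0] by [f 0] costs at most the error at
    0, hence the halved tolerance. *)
Lemma holo_poly_approx f (s e : R) : holomorphic f -> 0 < s < 1 -> 0 < e ->
  exists n (c : nat -> R[i]), c 0%N = f 0 /\ forall z, cabs z <= s ->
    cabs (f z - \sum_(k < n.+1) c k * z ^+ k) <= e.
Proof.
move=> fH s01 e0; have e20 : 0 < e / 2 by rewrite divr_gt0.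
have [n [c cP]] := holo_poly_approx0 fH s01 e20.
case: n => [|n] in cP *.
  exists 0%N, (fun=> f 0); split=> // z zs.
  rewrite big_ord_recl big_ord0 expr0 mulr1 addr0.
  have [/andP[s0 _]] := (s01, cP z zs).
  have := cP 0; rewrite cabs0 (ltW s0) !big_ord0 !subr0 => /(_ isT) ? ?.
  by apply: le_trans (cabsB _ _) _; lra.
exists n, (fun k => if k == 0%N then f 0 else c k); split=> // z zs.
move: (cP z zs) (cP 0); rewrite !big_ord_recl/= !expr0 !mulr1.
rewrite [in X in _ -> X -> _]big1 ?addr0; last first.
  by move=> k _; rewrite exprS mul0r mulr0.
rewrite cabs0 => H0 /(_ (ltW (andP s01).1)) H1.
have E (u v w x : R[i]) : u - (v + w) = (u - (x + w)) - (v - x) by ring.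
rewrite (E _ _ _ (c 0%N)).
by apply: le_trans (cabsB _ _) _; rewrite (splitr e); exact: lerD H0 H1.
Qed.

End cauchy.

(** * Harmonic mappings *)

Section harmonic.
Context {R : realType}.
Implicit Types (z w h : R[i]) (x y t : R) (f g : R[i] -> R[i]).
Local Notation Re := (@complex.Re R).
Local Notation Im := (@complex.Im R).
Local Notation I := (0 +i* 1 : R[i]).
Local Notation disk := (@Dr R 1).

Lemma ccontinuousD f g z : ccontinuous_at f z -> ccontinuous_at g z ->
  ccontinuous_at (fun w => f w + g w) z.
Proof.
move=> /ccontinuousP fz /ccontinuousP gz; apply/ccontinuousP => e e0.
have e20 : 0 < e / 2 by rewrite divr_gt0.
have [a a0 aP] := fz _ e20; have [b b0 bP] := gz _ e20.
exists (Num.min a b); first by rewrite lt_min a0.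
move=> w; rewrite lt_min => /andP[/aP fw /bP gw].
rewrite opprD addrACA (splitr e).
exact: le_lt_trans (cabsD _ _) (ltrD fw gw).
Qed.

Lemma ccontinuousMl a f z : ccontinuous_at f z ->
  ccontinuous_at (fun w => a * f w) z.
Proof.
move=> /ccontinuousP fz; apply/ccontinuousP => e e0.
have a1 : 0 < cabs a + 1 by rewrite ltr_wpDl ?cabs_ge0.
have [d d0 dP] := fz _ (divr_gt0 e0 a1).
exists d => // w /dP; rewrite ltr_pdivlMr// -mulrBr cabsM => H.
by apply: le_lt_trans H; rewrite mulrC ler_wpM2l ?cabs_ge0// lerDl.
Qed.

Lemma ccontinuous_conj f z : ccontinuous_at f z ->
  ccontinuous_at (fun w => (f w)^*) z.
Proof.
move=> /ccontinuousP H; apply/ccontinuousP => e e0; have [d d0 dP] := H e e0.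
by exists d => // w /dP; rewrite -rmorphB/= cabs_conj.
Qed.

Lemma ccontinuous_ext f g z : disk z -> (forall w, disk w -> f w = g w) ->
  ccontinuous_at f z -> ccontinuous_at g z.
Proof.
move=> zD fg /ccontinuousP H; apply/ccontinuousP => e e0.
have [d d0 dP] := H e e0; have [a a0 aP] := disk_nbhs zD.
exists (Num.min d a); first by rewrite lt_min d0.
by move=> w; rewrite lt_min => /andP[/dP+ /aP wD]; rewrite !fg.
Qed.

(** The candidates [fx] and [fy] agree with the partial derivatives only on the disk; as it is open,
    continuity passes over. *)
Lemma C1_onP f fx fy :
  (forall z, disk z -> has_cderiv (horiz_line f (Im z)) (Re z) (fx z)) ->
  (forall z, disk z -> has_cderiv (vert_line f (Re z)) (Im z) (fy z)) ->
  (forall z, disk z -> ccontinuous_at fx z) ->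
  (forall z, disk z -> ccontinuous_at fy z) ->
  C1_on disk f /\ forall z, disk z -> dx f z = fx z /\ dy f z = fy z.
Proof.
move=> fxP fyP fxc fyc.
have E z : disk z -> dx f z = fx z /\ dy f z = fy z.
  by move=> zD; split; [apply/dx_horiz/fxP|apply/dy_vert/fyP].
split=> // z zD; split.
- by have /has_cderivP[] := fxP z zD.
- by have /has_cderivP[] := fyP z zD.
- by apply: ccontinuous_ext (fxc z zD) => // w /E[].
- by apply: ccontinuous_ext (fyc z zD) => // w /E[].
Qed.

Lemma C1_comb a b f g : C1_on disk f -> C1_on disk g ->
  C1_on disk (fun z => a * f z + b * g z) /\ forall z, disk z ->
    dx (fun z => a * f z + b * g z) z = a * dx f z + b * dx g z /\
    dy (fun z => a * f z + b * g z) z = a * dy f z + b * dy g z.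
Proof.
move=> fC gC; apply: C1_onP => z zD.
- by apply: has_cderivD; apply: has_cderivMl; apply: C1_horiz.
- by apply: has_cderivD; apply: has_cderivMl; apply: C1_vert.
- by apply: ccontinuousD; apply: ccontinuousMl; apply: C1_dx_cont.
- by apply: ccontinuousD; apply: ccontinuousMl; apply: C1_dy_cont.
Qed.

Lemma C1_conj f : C1_on disk f ->
  C1_on disk (fun z => (f z)^*) /\ forall z, disk z ->
    dx (fun z => (f z)^*) z = (dx f z)^* /\
    dy (fun z => (f z)^*) z = (dy f z)^*.
Proof.
move=> fC; apply: C1_onP => z zD.
- by apply: has_cderiv_conj; apply: C1_horiz.
- by apply: has_cderiv_conj; apply: C1_vert.
- by apply: ccontinuous_conj; apply: C1_dx_cont.
- by apply: ccontinuous_conj; apply: C1_dy_cont.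
Qed.

Lemma I2 : I * I = -1.
Proof. by apply: complexP; rewrite !ReImE/=; ring. Qed.

(** The Cauchy-Riemann equation common to [dz f] and the conjugate of [dzbar f]. Up to conjugation,
    [u] is f_yy, so that [- u] is f_xx by harmonicity, and [v] is the mixed derivative. *)
Lemma wirtinger_CR (i u v : R[i]) : i * i = -1 ->
  2^-1 * v + - i / 2 * u = i * (2^-1 * - u + - i / 2 * v).
Proof.
move=> i2; rewrite (_ : i * _ = - (i * i) / 2 * v - i / 2 * u); last by ring.
by rewrite i2; ring.
Qed.

Lemma harmonic_holo_dz f : harmonic_mapping f -> holomorphic (dz f).
Proof.
move=> [fC2 fL]; have [fC fxC fyC] := fC2.
have -> : dz f = fun z => 2^-1 * dx f z + (- I / 2) * dy f z.
  by apply/funext => z; rewrite /dz; ring.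
have [C E] := C1_comb 2^-1 (- I / 2) fxC fyC.
split=> // z zD; have [-> ->] := E z zD.
have /eqP := fL z zD; rewrite /laplacian addr_eq0 => /eqP ->.
rewrite -(C2_schwarz fC2 zD).
exact: wirtinger_CR I2.
Qed.

Lemma harmonic_holo_dzbar f : harmonic_mapping f ->
  holomorphic (fun z => (dzbar f z)^*).
Proof.
move=> [fC2 fL]; have [fC fxC fyC] := fC2.
have [fxC' Ex] := C1_conj fxC; have [fyC' Ey] := C1_conj fyC.
have -> : (fun z => (dzbar f z)^*) =
    fun z => 2^-1 * (dx f z)^* + (- I / 2) * (dy f z)^*.
  have Ic : I^* = - I by apply: complexP; rewrite !ReImE /= ?oppr0.
  have E (i u v : R[i]) : i^* = - i ->
      ((u + i * v) / 2)^* = 2^-1 * u^* + - i / 2 * v^*.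
    by rewrite rmorphM rmorphD rmorphM fmorphV rmorph_nat => /= ->; ring.
  by apply/funext => z; exact: E.
have [C E] := C1_comb 2^-1 (- I / 2) fxC' fyC'.
split=> // z zD; have [-> ->] := E z zD.
have [-> ->] := Ex z zD; have [-> ->] := Ey z zD.
have /eqP := fL z zD; rewrite /laplacian addr_eq0 => /eqP ->.
rewrite -(C2_schwarz fC2 zD) [(- _)^*](rmorphN conjc).
exact: wirtinger_CR I2.
Qed.

Definition hpoly n (a b : nat -> R[i]) z : R[i] :=
  \sum_(k < n) (a k * z ^+ k.+1 + (b k * z ^+ k.+1)^*).

(** Padding with zero coefficients lets both Wirtinger derivatives be approximated in the same
    degree. *)
Lemma holo_poly_approx_ge f (s e : R) : holomorphic f -> 0 < s < 1 -> 0 < e ->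
  exists n (c : nat -> R[i]), c 0%N = f 0 /\ forall m z, (n <= m)%N ->
    cabs z <= s -> cabs (f z - \sum_(k < m) c k * z ^+ k) <= e.
Proof.
move=> fH s01 e0; have [n [c [c0 cP]]] := holo_poly_approx fH s01 e0.
exists n.+1, (fun k => if (k < n.+1)%N then c k else 0); split=> // m z nm zs.
have := cP z zs; rewrite (big_ord_widen m (fun k => c k * z ^+ k) nm).
rewrite big_mkcond/=; congr (cabs (_ - _) <= _); apply: eq_bigr => k _.
by case: ifP => //; rewrite mul0r.
Qed.

(** Integrate the approximations of the two Wirtinger derivatives term by term, dividing by [k.+1].
    The difference then has a differential of norm at most [e] on the closed disk, and the mean
    value inequality along a segment turns this into a Lipschitz bound. *)
Lemma harmonic_approx f (s e : R) : harmonic_mapping f -> 0 < s < 1 -> 0 < e ->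
  exists n a b, [/\ a 0%N = dz f 0, b 0%N = (dzbar f 0)^* &
    forall z w, cabs z <= s -> cabs w <= s ->
      cabs (f w - hpoly n.+1 a b w - (f z - hpoly n.+1 a b z)) <=
      e * cabs (w - z)].
Proof.
move=> fH s01 e0; have e20 : 0 < e / 2 by rewrite divr_gt0.
have [n1 [c [c0 cP]]] := holo_poly_approx_ge (harmonic_holo_dz fH) s01 e20.
have [n2 [d [d0 dP]]] := holo_poly_approx_ge (harmonic_holo_dzbar fH) s01 e20.
pose n := maxn n1 n2; have {}cP := cP n.+1 _ (leqW (leq_maxl _ _)).
have {}dP := dP n.+1 _ (leqW (leq_maxr _ _)).
pose a k := c k / k.+1%:R; pose b k := d k / k.+1%:R.
have aE k : k.+1%:R * a k = c k by rewrite mulrC divfK// pnatr_eq0.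
have bE k : k.+1%:R * b k = d k by rewrite mulrC divfK// pnatr_eq0.
exists n, a, b; split; rewrite /a /b ?divr1// => z w zs ws.
pose h := w - z; pose p t := z + t%:C * h.
have ps t : 0 <= t <= 1 -> cabs (p t) <= s.
  by apply: cball_segment; rewrite // subrKC.
suff : cabs (f (p 1) - hpoly n.+1 a b (p 1) -
    (f (p 0) - hpoly n.+1 a b (p 0))) <= e * cabs h.
  by rewrite /p mul1r mul0r subrKC addr0.
apply: (@cmvt_le _ (fun t => f (p t) - hpoly n.+1 a b (p t))
  (fun t => fdiff f (p t) h -
     \sum_(k < n.+1) (c k * p t ^+ k * h + (d k * p t ^+ k * h)^*))).
  move=> t t01; apply: has_cderivB.
    apply: C1_line; first by case: fH => -[].
    by apply: le_disk (ps t t01) _; case/andP: s01.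
  apply: has_cderiv_sum => k.
  have E (u : nat -> R[i]) v : u k = k.+1%:R * v ->
      has_cderiv (fun t => v * p t ^+ k.+1) t (u k * p t ^+ k * h).
    move=> ->; rewrite [X in has_cderiv _ _ X](_ : _ =
      v * (k.+1%:R * p t ^+ k * h)); last by ring.
    by apply/has_cderivMl/has_cderivX/has_cderiv_line.
  by apply: has_cderivD; last apply: has_cderiv_conj; apply: E.
move=> t /andP[t0 t1]; have {t0 t1} pts : cabs (p t) <= s by rewrite ps// !ltW.
rewrite fdiffE big_split/= -rmorph_sum/= -!mulr_suml.
rewrite [X in cabs X](_ : _ =
    (dz f (p t) - \sum_(k < n.+1) c k * p t ^+ k) * h
  + (((dzbar f (p t))^* - \sum_(k < n.+1) d k * p t ^+ k) * h)^*); last first.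
  have E (u v x : R[i]) : ((u^* - v) * x)^* = u * x^* - (v * x)^*.
    by rewrite mulrBl [LHS]rmorphB [X in X - _ = _]rmorphM/= conjcK.
  by rewrite E; ring.
apply: le_trans (cabsD _ _) _.
rewrite cabs_conj !cabsM -mulrDl ler_wpM2r ?cabs_ge0//.
by rewrite (splitr e); apply: lerD; [exact: cP|exact: dP].
Qed.

Lemma sum_prim_root_orth n (w : R[i]) k l : n.-primitive_root w ->
  (k < n)%N -> (l < n)%N ->
  \sum_(j < n) (w ^+ j) ^+ k * (w ^+ j) ^- l = if k == l then n%:R else 0.
Proof.
move=> wn kn ln.
have w0 : w != 0.
  apply: contraTneq (prim_order_gt0 wn) => w0; move: (prim_expr_order wn).
  by rewrite w0 expr0n; case: (n) => //= ? /eqP; rewrite eq_sym oner_eq0.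
have wj0 j : w ^+ j != 0 by rewrite expf_neq0.
case: (ltngtP k l) => [kl|lk|<-].
- rewrite -[RHS](@sum_prim_rootV _ n w (l - k)%N)//; last first.
    by rewrite subn_gt0 kl (leq_ltn_trans (leq_subr _ _) ln).
  apply: eq_bigr => j _; rewrite -{1}(subnK (ltnW kl)) exprD invfM.
  by rewrite mulrCA mulfV ?mulr1// expf_neq0.
- rewrite -[RHS](@sum_prim_root _ n w (k - l)%N)//; last first.
    by rewrite subn_gt0 lk (leq_ltn_trans (leq_subr _ _) kn).
  apply: eq_bigr => j _; rewrite -{1}(subnK (ltnW lk)) exprD.
  by rewrite mulfK// expf_neq0.
- under eq_bigr do rewrite mulfV ?expf_neq0//.
  by rewrite sumr_const card_ord.
Qed.

(* Averaging over the points [s * w ^+ j], for [w] a primitive root of unity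
   of order larger than [2 * n], makes the monomials exactly orthogonal. *)
Lemma hpoly_bessel n a b (s B : R) : 0 < s ->
  (forall z, cabs z = s -> cabs (hpoly n a b z) <= B) ->
  \sum_(k < n) (cabs (a k) ^+ 2 + cabs (b k) ^+ 2) * s ^+ (2 * k.+1) <= B ^+ 2.
Proof.
move=> s0 QB; pose m := (2 * n).+1; pose w : R[i] := cis (2 * pi / m%:R).
have wm : m.-primitive_root w := cis_prim_root _.
pose x j := w ^+ j.
have cx j : cabs (x j) = 1 by rewrite cabsX cabs_cis expr1n.
have x0 j : x j != 0 by rewrite -cabs_gt0 cx.
have xconj j : (x j)^* = (x j)^-1.
  by apply: (mulfI (x0 j)); rewrite mul_conjc cx expr1n mulfV.
pose A k := a k * s%:C ^+ k.+1; pose C k := b k * s%:C ^+ k.+1.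
pose q j := hpoly n a b (s%:C * x j).
have xXconj j k : (x j ^+ k)^* = x j ^- k by rewrite cconjX xconj exprVn.
have xVconj j k : (x j ^- k)^* = x j ^+ k by rewrite -xXconj conjcK.
have qE j : q j = \sum_(k < n) (A k * x j ^+ k.+1 + (C k)^* * x j ^- k.+1).
  apply: eq_bigr => k _; rewrite !exprMn !mulrA; congr (_ + _).
  by rewrite cconjM xXconj.
have qcE j : (q j)^* = \sum_(k < n) ((A k)^* * x j ^- k.+1 + C k * x j ^+ k.+1).
  rewrite qE cconj_sum; apply: eq_bigr => k _.
  by rewrite cconjD cconjM [X in _ + X]cconjM xXconj xVconj conjcK.
have km (k : 'I_n) : (k.+1 < m)%N.
  by rewrite ltnS (leq_trans (ltn_ord k))// leq_pmull.
have klm (k l : 'I_n) : (k.+1 + l.+1 < m)%N.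
  by rewrite ltnS mul2n -addnn leq_add.
have klm0 (k l : 'I_n) : (0 < k.+1 + l.+1 < m)%N by rewrite klm.
have sx (k l : 'I_n) : \sum_(j < m) x j ^+ (k.+1 + l.+1) = 0.
  exact: sum_prim_root.
have sxV (k l : 'I_n) : \sum_(j < m) x j ^- (k.+1 + l.+1) = 0.
  exact: sum_prim_rootV.
have sxx (k l : 'I_n) : \sum_(j < m) x j ^+ k.+1 * x j ^- l.+1 =
    if k == l then m%:R else 0.
  by rewrite sum_prim_root_orth// eqSS.
(* Exponents [k.+1 + l.+1] are positive and below [m], so those terms sum to 0; of the others only
   [l = k] survives. *)
have qA (k : 'I_n) : \sum_(j < m) (q j)^* * x j ^+ k.+1 = m%:R * (A k)^*.
  rewrite (eq_bigr (fun j : 'I_m => \sum_(l < n) ((A l)^* *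
      (x j ^+ k.+1 * x j ^- l.+1) + C l * x j ^+ (l.+1 + k.+1)))).
    rewrite exchange_big/= (eq_bigr (fun l : 'I_n =>
        (A l)^* * if k == l then m%:R else 0)).
      rewrite (bigD1 k)//= eqxx big1 ?addr0 1?mulrC// => l.
      by rewrite eq_sym => /negPf->; rewrite mulr0.
    by move=> l _; rewrite big_split/= -!mulr_sumr sx sxx mulr0 addr0.
  move=> j _; rewrite qcE mulr_suml; apply: eq_bigr => l _.
  by rewrite exprD; ring.
have qC (k : 'I_n) : \sum_(j < m) (q j)^* * x j ^- k.+1 = m%:R * C k.
  rewrite (eq_bigr (fun j : 'I_m => \sum_(l < n) ((A l)^* *
      x j ^- (l.+1 + k.+1) + C l * (x j ^+ l.+1 * x j ^- k.+1)))).
    rewrite exchange_big/= (eq_bigr (fun l : 'I_n =>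
        C l * if l == k then m%:R else 0)).
      rewrite (bigD1 k)//= eqxx big1 ?addr0 1?mulrC// => l.
      by move=> /negPf->; rewrite mulr0.
    by move=> l _; rewrite big_split/= -!mulr_sumr sxV sxx mulr0 add0r.
  move=> j _; rewrite qcE mulr_suml; apply: eq_bigr => l _.
  by rewrite exprD invfM; ring.
(* Expand one factor of |q_j|^2 and recognise in the other the sums [qA] and [qC]. *)
have S : \sum_(j < m) (cabs (q j) ^+ 2)%:C =
    m%:R * \sum_(k < n) (cabs (A k) ^+ 2 + cabs (C k) ^+ 2)%:C.
  rewrite (eq_bigr (fun j : 'I_m => \sum_(k < n)
     (A k * ((q j)^* * x j ^+ k.+1) + (C k)^* * ((q j)^* * x j ^- k.+1)))).
    rewrite exchange_big/= mulr_sumr; apply: eq_bigr => k _.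
    by rewrite big_split/= -!mulr_sumr qA qC realcD -!mul_conjc; ring.
  move=> j _; rewrite -mul_conjc {1}qE mulr_suml; apply: eq_bigr => k _.
  by ring.
have {S} : \sum_(j < m) cabs (q j) ^+ 2 =
    m%:R * \sum_(k < n) (cabs (A k) ^+ 2 + cabs (C k) ^+ 2).
  by apply: complex_inj; rewrite realcM realc_nat !realc_sum.
have : \sum_(j < m) cabs (q j) ^+ 2 <= m%:R * B ^+ 2.
  rewrite mulr_natl -[m in _ *+ m]card_ord -sumr_const; apply: ler_sum => j _.
  have qB : cabs (q j) <= B.
    by apply: QB; rewrite cabsM cx mulr1 cabs_real gtr0_norm.
  by rewrite ler_pXn2r ?nnegrE ?cabs_ge0//; exact: le_trans (cabs_ge0 _) qB.
move=> /[swap] ->; rewrite ler_pM2l ?ltr0n//; apply: le_trans.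
apply: ler_sum => k _; rewrite /A /C !cabsM !cabsX cabs_real gtr0_norm//.
by rewrite !exprMn -mulrDl -exprM mulnC.
Qed.

End harmonic.

(** * Bounded harmonic mappings *)

Section real_estimates.
Context {R : realType}.
Implicit Types (x s r e : R).

Lemma sum_cauchy_schwarz n (a b : nat -> R) :
  (\sum_(k < n) a k * b k) ^+ 2 <=
  (\sum_(k < n) a k ^+ 2) * (\sum_(k < n) b k ^+ 2).
Proof.
elim: n => [|n ih]; first by rewrite !big_ord0 expr0n/= mul0r.
rewrite !big_ord_recr/=; move: ih.
set S := \sum_(k < n) _; set A := \sum_(k < n) _; set B := \sum_(k < n) _.
have A0 : 0 <= A by apply: sumr_ge0 => k _; exact: sqr_ge0.
have B0 : 0 <= B by apply: sumr_ge0 => k _; exact: sqr_ge0.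
move: (a n) (b n) => u v SAB.
(* The cross term: compare squares, using [S ^+ 2 <= A * B] and 4XY <= (X + Y)^2 with X = A v^2, Y =
   u^2 B. *)
have : 2 * (S * (u * v)) <= A * v ^+ 2 + u ^+ 2 * B.
  have X0 : 0 <= A * v ^+ 2 + u ^+ 2 * B.
    by rewrite addr_ge0// mulr_ge0 ?sqr_ge0.
  apply: le_trans (ler_norm _) _; rewrite -(@ler_pXn2r _ 2) ?nnegrE//.
  rewrite real_normK ?num_real//.
  have : S ^+ 2 * (u * v) ^+ 2 <= A * B * (u * v) ^+ 2.
    by rewrite ler_wpM2r// sqr_ge0.
  have := sqr_ge0 (A * v ^+ 2 - u ^+ 2 * B).
  nra.
nra.
Qed.

Lemma sum_geom_le n x : 0 <= x < 1 ->
  \sum_(k < n) x ^+ k.+2 <= x ^+ 2 / (1 - x).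
Proof.
move=> /andP[x0 x1]; rewrite ler_pdivlMr ?subr_gt0//.
suff -> : (\sum_(k < n) x ^+ k.+2) * (1 - x) = x ^+ 2 - x ^+ n.+2.
  by rewrite gerBl exprn_ge0.
elim: n => [|n ih]; first by rewrite big_ord0 mul0r subrr.
by rewrite big_ord_recr/= mulrDl ih [x ^+ n.+3]exprS; ring.
Qed.

(** The right-hand side is the whole series of n^2 x^(n-1) over n >= 2. The proof finds the
    remainder in closed form, and it is nonnegative. *)
Lemma sum_sqr_geom_le n x : 0 <= x < 1 ->
  \sum_(k < n) (k.+2%:R ^+ 2 * x ^+ k.+1) <=
  x * (4 - 3 * x + x ^+ 2) / (1 - x) ^+ 3.
Proof.
move=> /andP[x0 x1]; have x1' : 0 < 1 - x by rewrite subr_gt0.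
rewrite ler_pdivlMr ?exprn_gt0//.
suff -> : (\sum_(k < n) (k.+2%:R ^+ 2 * x ^+ k.+1)) * (1 - x) ^+ 3 =
    x * (4 - 3 * x + x ^+ 2) - x ^+ n.+1 *
    (n.+1%:R ^+ 2 * (1 - x) ^+ 2 + 2 * n.+1%:R * (1 - x) + 1 + x).
  rewrite gerBl mulr_ge0 ?exprn_ge0// -exprMn.
  have := sqr_ge0 (n.+1%:R * (1 - x)).
  by have := mulr_ge0 (ler0n R n.+1) (ltW x1'); lra.
elim: n => [|n ih]; first by rewrite big_ord0 mul0r expr1 expr1n; ring.
rewrite big_ord_recr/= mulrDl ih -[n.+2%:R]natr1 [x ^+ n.+2]exprS; ring.
Qed.

(** For 0 <= r < 1 this is the square root of the sum of n^2 r^(2(n-1)) over n >= 2. *)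
Definition growth r : R :=
  r * Num.sqrt (r ^+ 4 - 3 * r ^+ 2 + 4) / (1 - r ^+ 2) `^ (3 / 2).

Lemma growthE r : 0 <= r < 1 ->
  growth r = Num.sqrt (r ^+ 2 * (4 - 3 * r ^+ 2 + (r ^+ 2) ^+ 2) /
                       (1 - r ^+ 2) ^+ 3).
Proof.
move=> /andP[r0 r1].
have r2 : 0 < 1 - r ^+ 2 by rewrite subr_gt0 expr_lt1.
rewrite sqrtrM; last first.
  apply: mulr_ge0; rewrite ?sqr_ge0//.
  by have := sqr_ge0 (r ^+ 2 - 3 / 2); nra.
rewrite sqrtrM ?sqr_ge0// sqrtr_sqr ger0_norm// sqrtrV; last first.
  by rewrite exprn_ge0// ltW.
rewrite /growth powRrM powR12_sqrt ?powR_ge0//.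
rewrite (powR_mulrn 3) ?(ltW r2)//.
by congr (_ * Num.sqrt _ / _); ring.
Qed.

(** A strict violation at [x] would persist just to its left. Estimates available only for [s < 1]
    are carried to 1 this way. *)
Lemma le_at_left (X l x : R) (Phi : R -> R) : l < x ->
  {for x, continuous Phi} -> (forall s, l < s < x -> X <= Phi s) -> X <= Phi x.
Proof.
move=> lx c H; rewrite leNgt; apply/negP => XPhi.
have d0 : 0 < X - Phi x by rewrite subr_gt0.
move/cvgrPdist_lt: c => /(_ _ d0)/nbhs_ballP[a /= a0 aP].
pose m := Num.max l (x - a).
have lm : l <= m by rewrite le_max lexx.
have am : x - a <= m by rewrite le_max lexx orbT.
have mx : m < x by rewrite gt_max lx/= ltrBlDr ltrDl.
clearbody m.
have sx : l < (m + x) / 2 < x by lra.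
have := aP ((m + x) / 2); rewrite /ball/= ger0_norm; last by lra.
have ma : x - (m + x) / 2 < a by lra.
move=> /(_ ma); rewrite distrC => /(le_lt_trans (ler_norm _)).
by have := H _ sx; lra.
Qed.

End real_estimates.

Section bounded_harmonic.
Context {R : realType}.
Implicit Types (z w h : R[i]) (f : R[i] -> R[i]) (s e : R).
Local Notation disk := (@Dr R 1).

(** |a|^2 + |b|^2 = (|a| - |b|)^2 + 2 |a| |b|. *)
Lemma lambda1_coef f z : lambda f z = 1 ->
  1 <= cabs (dz f z) ^+ 2 + cabs (dzbar f z) ^+ 2.
Proof.
rewrite /lambda => l1; have := cabs_ge0 (dz f z); have := cabs_ge0 (dzbar f z).
have : (cabs (dz f z) - cabs (dzbar f z)) ^+ 2 = 1.
  by rewrite -real_normK ?num_real// l1 expr1n.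
nra.
Qed.

Lemma hpoly0 n a b : hpoly n a b (0 : R[i]) = 0.
Proof.
by rewrite /hpoly big1// => k _; rewrite !exprS !mul0r !mulr0 conjc0 addr0.
Qed.

Lemma hpoly_recl n a b z : hpoly n.+1 a b z = a 0%N * z + (b 0%N)^* * z^* +
  \sum_(k < n) (a k.+1 * z ^+ k.+2 + (b k.+1 * z ^+ k.+2)^*).
Proof.
by rewrite /hpoly big_ord_recl/= expr1 cconjM.
Qed.

(** The weight [t] is left free: [k.+2%:R * r ^+ k.+1] serves for the Lipschitz constant and
    [r ^+ k.+2] for the distance to the linear part. *)
Lemma harmonic_coef_bound f (M s e : R) : harmonic_mapping f -> f 0 = 0 ->
  lambda f 0 = 1 -> (forall z, disk z -> cabs (f z) <= M) ->
  0 < s < 1 -> 0 < e ->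
  exists n a b,
  [/\ forall z w, cabs z <= s -> cabs w <= s ->
      cabs (f w - hpoly n.+1 a b w - (f z - hpoly n.+1 a b z)) <=
        e * cabs (w - z),
      forall z, hpoly n.+1 a b z = fdiff f 0 z +
        \sum_(k < n) (a k.+1 * z ^+ k.+2 + (b k.+1 * z ^+ k.+2)^*),
      s ^+ 2 <= (M + e) ^+ 2 &
      forall t : nat -> R, \sum_(k < n) (cabs (a k.+1) + cabs (b k.+1)) * t k <=
        Num.sqrt (2 * ((M + e) ^+ 2 - s ^+ 2)) *
        Num.sqrt (\sum_(k < n) (t k / s ^+ k.+2) ^+ 2)].
Proof.
move=> fH f0 fl fM s01 e0; have /andP[s0 s1] := s01.
have [n [a [b [a0 b0 H]]]] := harmonic_approx fH s01 e0.
exists n, a, b.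
(* Both [f] and [hpoly] vanish at 0, so they differ by at most [e * s] on the circle. *)
have HB z : cabs z = s -> cabs (hpoly n.+1 a b z) <= M + e.
  move=> zs; have := H 0 z; rewrite hpoly0 f0 cabs0 zs lexx (ltW s0) !subr0.
  move=> /(_ isT isT); have : cabs (f z) <= M by apply: fM; rewrite DrE zs.
  have := ler_cabsB (hpoly n.+1 a b z) (f z); rewrite cabsBC zs; nra.
have := hpoly_bessel s0 HB; rewrite big_ord_recl/= muln1.
have := lambda1_coef fl; rewrite a0 b0 cabs_conj.
set c := (X in 1 <= X) => c1 bes.
have s20 : 0 < s ^+ 2 by rewrite exprn_gt0.
have {bes} : s ^+ 2 + \sum_(k < n) (cabs (a k.+1) ^+ 2 + cabs (b k.+1) ^+ 2) *
    s ^+ (2 * k.+2) <= (M + e) ^+ 2.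
  by apply: le_trans bes; rewrite lerD2r ler_peMl// ltW.
set T := \sum_(k < n) _ => bes.
have T0 : 0 <= T.
  apply: sumr_ge0 => k _; rewrite mulr_ge0 ?exprn_ge0 ?(ltW s0)//.
  by rewrite addr_ge0 ?sqr_ge0.
split=> //.
- move=> z; rewrite hpoly_recl fdiffE a0 b0 conjcK//.
- lra.
move=> t.
(* Powers of [s] move from the weights to the coefficients, so that after Cauchy-Schwarz the first
   factor is the one bounded by Parseval's identity. *)
pose u k := (cabs (a k.+1) + cabs (b k.+1)) * s ^+ k.+2.
pose v k := t k / s ^+ k.+2.
rewrite (eq_bigr (fun k : 'I_n => u k * v k)); last first.
  by move=> k _; rewrite /u /v; field; rewrite expf_neq0// gt_eqF.
rewrite -sqrtrM; last by rewrite mulr_ge0//; lra.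
apply: le_trans (ler_norm _) _; rewrite -sqrtr_sqr ler_wsqrtr//.
apply: le_trans (sum_cauchy_schwarz _ _ _) _.
rewrite ler_wpM2r// ?sumr_ge0// => [k _|]; first exact: sqr_ge0.
apply: (@le_trans _ _ (2 * T)); last by lra.
rewrite mulr_sumr; apply: ler_sum => k _.
rewrite /u exprMn -exprM [(k.+2 * 2)%N]mulnC mulrA ler_wpM2r//.
  by rewrite exprn_ge0// ltW.
have := sqr_ge0 (cabs (a k.+1) - cabs (b k.+1)); nra.
Qed.

(** The degree-one term of Parseval's identity alone gives s <= M + e', with s at least 1 - e'. *)
Lemma bound_ge1 f (M : R) : harmonic_mapping f -> f 0 = 0 ->
  lambda f 0 = 1 -> (forall z, disk z -> cabs (f z) <= M) -> 1 <= M.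
Proof.
move=> fH f0 fl fM.
have M0 : 0 <= M by apply: le_trans (fM 0 _); rewrite ?cabs_ge0// DrE cabs0.
apply/ler_addgt0Pr => e e0.
pose e' := e / 2; have e'0 : 0 < e' by rewrite divr_gt0.
pose s := Num.max (1 / 2) (1 - e') : R.
have s0 : 0 < s by rewrite lt_max divr_gt0.
have s1 : s < 1 by rewrite gt_max; lra.
have se : 1 - e' <= s by rewrite le_max lexx orbT.
have [|n [a [b [_ _ + _]]]] := harmonic_coef_bound fH f0 fl fM (s := s) _ e'0.
  by rewrite s0.
rewrite ler_pXn2r ?nnegrE ?addr_ge0 ?(ltW s0) ?(ltW e'0)// => sM.
by rewrite (splitr e) -/e'; lra.
Qed.

Lemma cabs_powB_le (r : R) z w n : cabs z <= r -> cabs w <= r ->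
  cabs (w ^+ n.+1 - z ^+ n.+1) <= n.+1%:R * r ^+ n * cabs (w - z).
Proof.
move=> zr wr; rewrite subrXX cabsM mulrC ler_wpM2r ?cabs_ge0//.
apply: le_trans (cabs_sum _ _ _) _.
rewrite mulr_natl -[X in _ *+ X](card_ord n.+1) -sumr_const.
apply: ler_sum => k _.
rewrite cabsM !cabsX; have kn : (k <= n)%N by rewrite -ltnS.
rewrite -[in leRHS](subnK kn) exprD.
have r0 := le_trans (cabs_ge0 z) zr.
by apply: ler_pM; rewrite ?exprn_ge0 ?cabs_ge0// lerXn2r ?nnegrE ?cabs_ge0.
Qed.

Lemma harmonic_lipschitz f (M r : R) : harmonic_mapping f -> f 0 = 0 ->
  lambda f 0 = 1 -> (forall z, disk z -> cabs (f z) <= M) -> 0 <= r < 1 ->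
  forall z w, cabs z <= r -> cabs w <= r ->
    cabs (f w - fdiff f 0 w - (f z - fdiff f 0 z)) <=
    Num.sqrt (2 * M ^+ 2 - 2) * growth r * cabs (w - z).
Proof.
move=> fH f0 fl fM r01 z w zr wr; have /andP[r0 r1] := r01.
have [->|wz] := eqVneq w z; first by rewrite !subrr cabs0 mulr0.
have wz0 : 0 < cabs (w - z) by rewrite cabs_gt0 subr_eq0.
rewrite -ler_pdivrMr// growthE//.
pose D s := r * r / (s * s).
pose Phi s := 1 - s + Num.sqrt (2 * ((M + (1 - s)) * (M + (1 - s)) - s * s)) *
  Num.sqrt (D s * (4 - 3 * D s + D s * D s) /
            ((1 - D s) * (1 - D s) * (1 - D s)) / (s * s)).
have -> : Num.sqrt (2 * M ^+ 2 - 2) * Num.sqrt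
    (r ^+ 2 * (4 - 3 * r ^+ 2 + (r ^+ 2) ^+ 2) / (1 - r ^+ 2) ^+ 3) = Phi 1.
  rewrite /Phi /D !mulr1 divr1 subrr addr0 add0r.
  congr (Num.sqrt _ * Num.sqrt _); first by ring.
  by rewrite divr1; congr (_ / _); ring.
have r20 : 1 - r * r != 0 by rewrite gt_eqF// subr_gt0 -expr2 expr_lt1.
apply: (@le_at_left _ _ r 1) => //.
  have ids : s @[s --> (1 : R)] --> (1 : R) by exact: cvg_id.
  have cst c : c @[s --> (1 : R)] --> (c : R) by exact: cvg_cst.
  have ss : s * s @[s --> (1 : R)] --> (1 * 1 : R) by exact: cvgM.
  have cD : D s @[s --> (1 : R)] --> D 1.
    apply: cvgM => //; apply: cvgV; last exact: ss.
    by rewrite mulr1 oner_eq0.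
  have c1D : 1 - D s @[s --> (1 : R)] --> 1 - D 1 by exact: cvgB.
  apply: cvgD; first exact: cvgB.
  apply: cvgM.
    apply: continuous_cvg; first exact: sqrt_continuous.
    apply: cvgM => //; apply: cvgB => //.
    by apply: cvgM; apply: cvgD => //; apply: cvgB.
  apply: continuous_cvg; first exact: sqrt_continuous.
  apply: cvgM; last first.
    by apply: cvgV => //; rewrite mulr1 oner_eq0.
  apply: cvgM.
    apply: cvgM => //; apply: cvgD; last exact: cvgM.
    by apply: cvgB => //; exact: cvgM.
  apply: cvgV; first by rewrite /D !mulr1 divr1 !mulf_neq0.
  by do 2?apply: cvgM.
move=> s /andP[rs s1]; have s0 : 0 < s by exact: le_lt_trans rs.
have [||n [a [b [H1 H2 _ H3]]]] := harmonic_coef_bound fH f0 fl fM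
  (s := s) (e := 1 - s).
- by rewrite s0.
- by rewrite subr_gt0.
rewrite ler_pdivrMr//.
have zs := le_trans zr (ltW rs); have ws := le_trans wr (ltW rs).
set U := \sum_(k < n) (a k.+1 * w ^+ k.+2 + (b k.+1 * w ^+ k.+2)^*).
set V := \sum_(k < n) (a k.+1 * z ^+ k.+2 + (b k.+1 * z ^+ k.+2)^*).
have -> : f w - fdiff f 0 w - (f z - fdiff f 0 z) =
    (f w - hpoly n.+1 a b w - (f z - hpoly n.+1 a b z)) + (U - V).
  by rewrite !H2 -/U -/V; ring.
apply: le_trans (cabsD _ _) _; rewrite mulrDl; apply: lerD; first exact: H1.
apply: (@le_trans _ _ ((\sum_(k < n) (cabs (a k.+1) + cabs (b k.+1)) *
    (k.+2%:R * r ^+ k.+1)) * cabs (w - z))).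
  rewrite -sumrB mulr_suml; apply: le_trans (cabs_sum _ _ _) _.
  apply: ler_sum => k _.
  rewrite [X in cabs X](_ : _ = a k.+1 * (w ^+ k.+2 - z ^+ k.+2) +
    (b k.+1 * (w ^+ k.+2 - z ^+ k.+2))^*); last first.
    by rewrite mulrBr [in RHS]mulrBr cconjB; ring.
  apply: le_trans (cabsD _ _) _; rewrite cabs_conj !cabsM -mulrDl -mulrA.
  by rewrite ler_wpM2l ?addr_ge0 ?cabs_ge0// cabs_powB_le.
rewrite ler_wpM2r ?cabs_ge0//.
apply: le_trans (H3 (fun k => k.+2%:R * r ^+ k.+1)) _.
have Ds : 0 <= D s < 1.
  rewrite /D divr_ge0 ?mulr_ge0 ?(ltW s0)//= ltr_pdivrMr ?mulr_gt0//.
  by rewrite mul1r ltr_pM.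
rewrite -!expr2 ler_wpM2l ?sqrtr_ge0// ler_wsqrtr// -exprSr.
rewrite ler_pdivlMr ?exprn_gt0// mulr_suml.
apply: le_trans (sum_sqr_geom_le n Ds); apply: ler_sum => k _.
rewrite le_eqVlt; apply/orP; left; apply/eqP.
have -> : s ^+ k.+2 = s * s ^+ k.+1 by rewrite exprS.
rewrite /D [(r * r / _) ^+ _]expr_div_n !exprMn.
have sk0 : s ^+ k.+1 != 0 by rewrite expf_neq0// gt_eqF.
move: sk0; move: (s ^+ k.+1) (r ^+ k.+1) => sk rk sk0.
by field; rewrite sk0 gt_eqF.
Qed.

(** The argument of [harmonic_lipschitz] with one endpoint at 0 and weights r^n: the sum of r^(2n)
    over n >= 2 is r^4 / (1 - r^2). *)
Lemma harmonic_dist_linear f (M r : R) : harmonic_mapping f -> f 0 = 0 ->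
  lambda f 0 = 1 -> (forall z, disk z -> cabs (f z) <= M) -> 0 <= r < 1 ->
  forall z, cabs z <= r ->
    cabs (f z - fdiff f 0 z) <=
    Num.sqrt (2 * M ^+ 2 - 2) * (r ^+ 2 / Num.sqrt (1 - r ^+ 2)).
Proof.
move=> fH f0 fl fM r01 z zr; have /andP[r0 r1] := r01.
have r20 : 0 < 1 - r * r by rewrite subr_gt0 -expr2 expr_lt1.
have -> : r ^+ 2 / Num.sqrt (1 - r ^+ 2) =
    Num.sqrt ((r * r) * (r * r) / (1 - r * r)).
  rewrite -!expr2 sqrtrM ?sqr_ge0// sqrtrV ?(expr2, ltW)//.
  by rewrite sqrtr_sqr ger0_norm// mulr_ge0.
pose D s := r * r / (s * s).
pose Phi s := 1 - s + Num.sqrt (2 * ((M + (1 - s)) * (M + (1 - s)) - s * s)) *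
  Num.sqrt (D s * D s / (1 - D s)).
have -> : Num.sqrt (2 * M ^+ 2 - 2) *
    Num.sqrt ((r * r) * (r * r) / (1 - r * r)) = Phi 1.
  rewrite /Phi /D !mulr1 divr1 subrr addr0 add0r.
  by congr (Num.sqrt _ * Num.sqrt _); ring.
apply: (@le_at_left _ _ r 1) => //.
  have ids : s @[s --> (1 : R)] --> (1 : R) by exact: cvg_id.
  have cst c : c @[s --> (1 : R)] --> (c : R) by exact: cvg_cst.
  have ss : s * s @[s --> (1 : R)] --> (1 * 1 : R) by exact: cvgM.
  have cD : D s @[s --> (1 : R)] --> D 1.
    apply: cvgM => //; apply: cvgV; last exact: ss.
    by rewrite mulr1 oner_eq0.
  apply: cvgD; first exact: cvgB.
  apply: cvgM.
    apply: continuous_cvg; first exact: sqrt_continuous.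
    apply: cvgM => //; apply: cvgB => //.
    by apply: cvgM; apply: cvgD => //; apply: cvgB.
  apply: continuous_cvg; first exact: sqrt_continuous.
  apply: cvgM; first exact: cvgM.
  apply: cvgV; first by rewrite /D !mulr1 divr1 gt_eqF.
  exact: cvgB.
move=> s /andP[rs s1]; have s0 : 0 < s by exact: le_lt_trans rs.
have [||n [a [b [H1 H2 _ H3]]]] := harmonic_coef_bound fH f0 fl fM
  (s := s) (e := 1 - s).
- by rewrite s0.
- by rewrite subr_gt0.
have zs := le_trans zr (ltW rs).
have := H1 0 z; rewrite cabs0 hpoly0 f0 !subr0 => /(_ (ltW s0) zs) {}H1.
have -> : f z - fdiff f 0 z = f z - hpoly n.+1 a b z +
    \sum_(k < n) (a k.+1 * z ^+ k.+2 + (b k.+1 * z ^+ k.+2)^*).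
  by rewrite !H2; ring.
apply: le_trans (cabsD _ _) _; apply: lerD.
  apply: le_trans H1 _; rewrite ler_piMr ?subr_ge0 ?(ltW s1)//.
  by rewrite (le_trans zs)// ltW.
apply: (@le_trans _ _ (\sum_(k < n) (cabs (a k.+1) + cabs (b k.+1)) *
    r ^+ k.+2)).
  apply: le_trans (cabs_sum _ _ _) _; apply: ler_sum => k _.
  have E c : cabs (c * z ^+ k.+2) = cabs c * cabs z ^+ k.+2.
    by rewrite cabsM cabsX.
  apply: le_trans (cabsD _ _) _; rewrite cabs_conj !E -mulrDl.
  by rewrite ler_wpM2l ?addr_ge0 ?cabs_ge0// lerXn2r ?nnegrE ?cabs_ge0.
apply: le_trans (H3 (fun k => r ^+ k.+2)) _.
have Ds : 0 <= D s < 1.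
  rewrite /D divr_ge0 ?mulr_ge0 ?(ltW s0)//= ltr_pdivrMr ?mulr_gt0//.
  by rewrite mul1r ltr_pM.
rewrite -!expr2 ler_wpM2l ?sqrtr_ge0// ler_wsqrtr//.
apply: le_trans (sum_geom_le n Ds); apply: ler_sum => k _.
by rewrite /D -!expr2 -!expr_div_n -!exprM mulnC.
Qed.

End bounded_harmonic.

(** * Elliptic mappings *)

Section elliptic.
Context {R : realType}.
Implicit Types (z w h : R[i]) (f : R[i] -> R[i]) (a b c d r s e : R).
Local Notation Re := (@complex.Re R).
Local Notation Im := (@complex.Im R).
Local Notation disk := (@Dr R 1).

Lemma area_rect a b c d : a <= b -> c <= d ->
  area (rect a b c d) = ((b - a) * (d - c))%:E.
Proof.
move=> ab cd.
have -> : area (rect a b c d) = (@lebesgue_measure R `[a, b]%classic *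
    @lebesgue_measure R `[c, d]%classic)%E.
  by apply: product_measure1E; exact: measurable_itv.
rewrite !lebesgue_measure_itv/= !lte_fin.
case: ltgtP ab => [_|//|->] _; last by rewrite mul0e subrr mul0r.
by case: ltgtP cd => [_|//|->] _; rewrite ?mule0 ?subrr ?mulr0.
Qed.

Lemma measurable_rect a b c d : measurable (rect a b c d).
Proof. exact: measurableX. Qed.

(** A null set contains no square of positive area. *)
Lemma ae_in_dense (P : R[i] -> Prop) : ae_in disk P ->
  forall z d, disk z -> 0 < d -> exists w, [/\ cabs (w - z) < d, disk w & P w].
Proof.
move=> [B [mB B0 BP]] z d zD d0; apply: contrapT => nP.
have [a a0 aP] := disk_nbhs zD.
pose m := Num.min a d / 3.
have m0 : 0 < m by rewrite divr_gt0// lt_min a0.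
have /andP[ma md] : (2 * m < a) && (2 * m < d).
  by rewrite -lt_min /m; move: m0; rewrite /m; lra.
pose Q := rect (Re z - m) (Re z + m) (Im z - m) (Im z + m).
have QB : Q `<=` B.
  move=> q [/= q1 q2]; apply: BP => /= H; apply: nP.
  have qz : cabs (complex_of_pair q - z) <= 2 * m.
    apply: le_trans (cabs_le_ReIm _) _; rewrite !ReImE/=.
    move: q1 q2; rewrite !in_itv/= => /andP[? ?] /andP[? ?].
    by rewrite (_ : 2 * m = m + m); [apply: lerD; rewrite ler_norml; lra|ring].
  exists (complex_of_pair q).
  have qD : disk (complex_of_pair q) by apply: aP; exact: le_lt_trans ma.
  by split=> //; [exact: le_lt_trans md|exact: H].
have : (area Q <= area B)%E.
  by apply: le_measure => //; rewrite inE//; exact: measurable_rect.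
rewrite B0 area_rect; [|lra|lra]; rewrite lee_fin.
by rewrite leNgt => /negP; apply; rewrite mulr_gt0//; lra.
Qed.

Lemma jac_factor f z : wirtinger_jac f z =
  (cabs (dz f z) - cabs (dzbar f z)) * bigLambda f z.
Proof. by rewrite /wirtinger_jac /bigLambda subr_sqr. Qed.

Lemma bigLambda_ge0 f z : 0 <= bigLambda f z.
Proof. by rewrite addr_ge0 ?cabs_ge0. Qed.

Lemma jac_lambda f z : 0 <= wirtinger_jac f z ->
  wirtinger_jac f z = lambda f z * bigLambda f z.
Proof.
rewrite jac_factor => J0; rewrite /lambda.
(* When the difference is negative, a nonnegative Jacobian forces [bigLambda f z = 0], and both
   sides vanish. *)
case: ger0P => [//|?].
have : bigLambda f z <= 0 by rewrite leNgt; apply/negP => ?; nra.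
move=> L0.
by rewrite (@le_anti _ _ (bigLambda f z) 0) ?mulr0// L0 bigLambda_ge0.
Qed.

(** Completing the square: (2x - b)^2 <= b^2 + 4c. *)
Lemma quadratic_bound (x b c : R) : 0 <= b -> 0 <= c -> 0 <= x ->
  x ^+ 2 <= b * x + c -> x <= (b + Num.sqrt (b ^+ 2 + 4 * c)) / 2.
Proof.
move=> b0 c0 x0 H; rewrite ler_pdivlMr// -lerBlDl.
apply: le_trans (ler_norm _) _; rewrite -sqrtr_sqr ler_wsqrtr//; nra.
Qed.

(** At points where ellipticity holds, [jac_lambda] turns it into Lambda^2 <= K L Lambda + K'; such
    points are dense and the Wirtinger derivatives are continuous. Positivity of [L] comes from a
    point with nonzero Jacobian. *)
Lemma elliptic_bound (K K' L : R) f : 1 <= K -> 0 <= K' ->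
  elliptic_harmonic K K' f -> (forall z, disk z -> lambda f z <= L) ->
  0 < L /\ forall z, disk z ->
    bigLambda f z <= (K * L + Num.sqrt (K ^+ 2 * L ^+ 2 + 4 * K')) / 2.
Proof.
move=> K1 K'0 [[fJ _ [_ fJ0] fK] [[fC _ _] _]] fL.
have d00 : disk 0 by rewrite DrE cabs0.
have L0 : 0 < L.
  have [w [_ wD J0]] := ae_in_dense fJ0 d00 ltr01.
  apply: lt_le_trans (fL w wD); rewrite /lambda normr_gt0.
  by apply: contraNneq J0 => E; rewrite jac_factor E mul0r.
split=> // z zD; set Lp := (X in _ <= X).
apply/ler_addgt0Pr => e e0; have e20 : 0 < e / 2 by rewrite divr_gt0.
have cc (c : R[i]) : ccontinuous_at (fun w => (dx f w + c * dy f w) / 2) z.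
  have -> : (fun w => (dx f w + c * dy f w) / 2) =
      (fun w => 2^-1 * dx f w + (c / 2) * dy f w).
    by apply/funext => w; ring.
  by apply: ccontinuousD; apply: ccontinuousMl;
    [exact: C1_dx_cont|exact: C1_dy_cont].
have c1 : ccontinuous_at (dz f) z.
  have -> : dz f = fun w => (dx f w + (- (0 +i* 1)) * dy f w) / 2.
    by apply/funext => w; rewrite /dz mulNr.
  exact: cc.
have c2 : ccontinuous_at (dzbar f) z := cc _.
have [d1 d10 d1P] := iffLR (ccontinuousP _ _) c1 _ e20.
have [d2 d20 d2P] := iffLR (ccontinuousP _ _) c2 _ e20.
have d0 : 0 < Num.min d1 d2 by rewrite lt_min d10.
have [w [wz wD]] := ae_in_dense fK zD d0.
move: wz; rewrite lt_min => /andP[/d1P w1 /d2P w2].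
rewrite (jac_lambda (fJ w wD)) => wK.
have wL : bigLambda f w <= Lp.
  have KL : 0 <= K * L by rewrite mulr_ge0 ?(ltW L0)//; lra.
  rewrite /Lp -exprMn; apply: quadratic_bound; rewrite ?bigLambda_ge0//.
  apply: le_trans wK _; rewrite lerD2r mulrA ler_wpM2r ?bigLambda_ge0//.
  by rewrite ler_wpM2l ?fL//; lra.
have := ler_cabsB (dz f z) (dz f w); have := ler_cabsB (dzbar f z) (dzbar f w).
move: wL; rewrite /bigLambda ![cabs (_ f z - _)]cabsBC.
move: w1 w2; move: (cabs (dz f w - _)) (cabs (dzbar f w - _)).
move: (cabs (dz f w)) (cabs (dz f z)) (cabs (dzbar f w)) (cabs (dzbar f z)).
by clear -e0 => *; lra.
Qed.

Lemma C1_lipschitz f (L : R) : C1_on disk f ->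
  (forall z, disk z -> bigLambda f z <= L) ->
  forall z w, disk z -> disk w -> cabs (f w - f z) <= L * cabs (w - z).
Proof.
move=> fC fL z w zD wD; pose h := w - z.
have seg t : 0 <= t <= 1 -> disk (z + t%:C * h).
  move=> t01; rewrite DrE; apply: disk_segment; rewrite // -DrE//.
  by rewrite subrKC.
have -> : f w - f z = f (z + 1%:C * h) - f (z + 0%:C * h).
  by rewrite mul1r mul0r addr0 subrKC.
apply: (@cmvt_le _ (fun t => f (z + t%:C * h))
  (fun t => fdiff f (z + t%:C * h) h)).
  by move=> t /seg; exact: C1_line.
move=> t /andP[t0 t1]; apply: le_trans (cabs_fdiff _ _ _) _.
by rewrite ler_wpM2r ?cabs_ge0//; apply/fL/seg; rewrite !ltW.
Qed.

Lemma sub_pow_le (x y r : R) n : 0 <= x <= r -> 0 <= y <= r ->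
  `|x ^+ n - y ^+ n| <= n%:R * r ^+ n.-1 * `|x - y|.
Proof.
case: n => [|n] /andP[x0 xr] /andP[y0 yr].
  by rewrite !expr0 subrr normr0 !mul0r.
have := @cabs_powB_le R r y%:C x%:C n; rewrite -!realcX -!realcB !cabs_real.
by rewrite (ger0_norm x0) (ger0_norm y0); apply.
Qed.

(** Split the difference as (|w|^m - |z|^m) f(w) + |z|^m (f(w) - f(z)). The first part contributes m
    r^(m-1) times L r, the second r^m L; with m = 2(k-1) the factor is 2k - 1. *)
Lemma weighted_lipschitz f (L r : R) m : 0 <= L -> 0 <= r < 1 -> f 0 = 0 ->
  (forall z w, disk z -> disk w -> cabs (f w - f z) <= L * cabs (w - z)) ->
  forall z w, cabs z <= r -> cabs w <= r ->
    cabs (`|w| ^+ m * f w - `|z| ^+ m * f z) <=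
    m.+1%:R * L * r ^+ m * cabs (w - z).
Proof.
move=> L0 /andP[r0 r1] f0 fL z w zr wr.
have zD := le_disk zr r1; have wD := le_disk wr r1.
have d00 : disk 0 by rewrite DrE cabs0.
rewrite !norm_cabs -!realcX.
have -> (u v : R[i]) (a b : R) : a%:C * u - b%:C * v =
  (a - b)%:C * u + b%:C * (u - v) by rewrite realcB; ring.
apply: le_trans (cabsD _ _) _; rewrite !cabsM !cabs_real.
rewrite -natr1 !mulrDl mul1r; apply: lerD; last first.
  rewrite [L * _]mulrC -mulrA.
  apply: ler_pM; rewrite ?normr_ge0 ?cabs_ge0 ?fL//.
  by rewrite ger0_norm ?exprn_ge0 ?cabs_ge0// lerXn2r ?nnegrE ?cabs_ge0.
have fw : cabs (f w) <= L * r.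
  have := fL 0 w d00 wD; rewrite f0 !subr0 => /le_trans; apply.
  by rewrite ler_wpM2l.
have dzw : `|cabs w - cabs z| <= cabs (w - z).
  rewrite ler_norml; have := ler_cabsB w z; have := ler_cabsB z w.
  by rewrite [cabs (z - w)]cabsBC; lra.
have := @sub_pow_le (cabs w) (cabs z) r m; rewrite !cabs_ge0 => /(_ wr zr) H.
case: m => [|m] in H *; first by rewrite !expr0 subrr normr0 !mul0r.
apply: le_trans (ler_pM _ _ H fw) _; rewrite ?normr_ge0 ?cabs_ge0//.
rewrite -pred_Sn [r ^+ m.+1]exprSr.
have -> : m.+1%:R * r ^+ m * `|cabs w - cabs z| * (L * r) =
  m.+1%:R * L * (r ^+ m * r) * `|cabs w - cabs z| by ring.
by rewrite ler_wpM2l// !mulr_ge0// exprn_ge0.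
Qed.

Lemma weighted_bound f (L r : R) m : 0 <= L -> 0 <= r < 1 -> f 0 = 0 ->
  (forall z w, disk z -> disk w -> cabs (f w - f z) <= L * cabs (w - z)) ->
  forall z, cabs z <= r -> cabs (`|z| ^+ m * f z) <= r ^+ m.+1 * L.
Proof.
move=> L0 /andP[r0 r1] f0 fL z zr.
have d00 : disk 0 by rewrite DrE cabs0.
rewrite norm_cabs -realcX cabsM cabs_real ger0_norm ?exprn_ge0 ?cabs_ge0//.
rewrite exprSr -mulrA; apply: ler_pM; rewrite ?exprn_ge0 ?cabs_ge0//.
  by rewrite lerXn2r ?nnegrE ?cabs_ge0.
have := fL 0 z d00 (le_disk zr r1); rewrite f0 !subr0 => /le_trans; apply.
by rewrite mulrC ler_wpM2r.
Qed.

End elliptic.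

(** * Perturbation of a linear map *)

Section linear_perturbation.
Context {R : realType}.
Implicit Types (z w h : R[i]) (r s : R).
Variables (F l : R[i] -> R[i]) (B r2 : R) (k S : R -> R).
Hypothesis lB : forall z w, l (w - z) = l w - l z.
Hypothesis l_ge : forall h, cabs h <= cabs (l h).
Hypothesis l_le : forall h, cabs (l h) <= B * cabs h.
Hypothesis l_onto : forall w, exists h, l h = w.
Hypothesis F0 : F 0 = 0.
Hypothesis r20 : 0 < r2.
Hypothesis S0 : 0 < S r2.
Hypothesis k1 : forall r, 0 <= r < r2 -> k r < 1.
Hypothesis F_lip : forall r, 0 <= r < r2 -> forall z w,
  cabs z <= r -> cabs w <= r ->
  cabs (F w - l w - (F z - l z)) <= k r * cabs (w - z).
Hypothesis F_bound : forall r, 0 <= r < r2 -> forall z,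
  cabs z <= r -> cabs (F z - l z) <= r - S r.
(** The contraction [k r < 1] is available only below [r2]; each target of modulus less than [S r2]
    is therefore handled at some smaller radius. *)
Hypothesis S_left : forall s, s < S r2 -> exists2 r, 0 <= r < r2 & s <= S r.

Lemma perturb_expand r : 0 <= r < r2 -> forall z w,
  cabs z <= r -> cabs w <= r -> (1 - k r) * cabs (w - z) <= cabs (F w - F z).
Proof.
move=> rr z w zr wr; have := F_lip rr zr wr.
have -> : F w - l w - (F z - l z) = (F w - F z) - l (w - z).
  by rewrite lB; ring.
have := ler_cabsB (l (w - z)) (F w - F z); rewrite [X in _ <= X -> _]cabsBC.
by have := l_ge (w - z); rewrite mulrBl mul1r; lra.
Qed.

Lemma perturb_univalent : univalent (Dr r2) F.
Proof.
move=> z w /set_mem; rewrite DrE => zD /set_mem; rewrite DrE => wD zw.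
have rr : 0 <= Num.max (cabs z) (cabs w) < r2.
  by rewrite le_max cabs_ge0 gt_max zD wD.
have := @perturb_expand _ rr w z; rewrite !le_max !lexx orbT zw subrr cabs0.
move=> /(_ isT isT); rewrite pmulr_rle0 ?subr_gt0 ?k1// => H.
apply/eqP; rewrite -subr_eq0 -cabs_eq0.
by apply/eqP/le_anti; rewrite H cabs_ge0.
Qed.

Lemma perturb_continuous z : Dr r2 z -> ccontinuous_at F z.
Proof.
rewrite DrE => zr; apply/ccontinuousP => e e0.
have zr' : cabs z < (cabs z + r2) / 2 < r2 by lra.
set r := (cabs z + r2) / 2 in zr'; have /andP[zr1 zr2] := zr'.
have r0 : 0 <= r by rewrite (le_trans (cabs_ge0 z))// ltW.
have rr : 0 <= r < r2 by rewrite r0.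
have C1 : 0 < `|B| + 1 by rewrite ltr_wpDl.
exists (Num.min (r - cabs z) (e / (`|B| + 1))).
  by rewrite lt_min subr_gt0 zr1 divr_gt0.
move=> w; rewrite lt_min ltr_pdivlMr// => /andP[wz we].
have wr : cabs w <= r by have := ler_cabsB w z; lra.
apply: le_lt_trans we.
have -> : F w - F z = (F w - l w - (F z - l z)) + l (w - z) by rewrite lB; ring.
apply: le_trans (cabsD _ _) _; rewrite mulrDr mulr1 addrC; apply: lerD.
  apply: le_trans (l_le _) _; rewrite mulrC ler_wpM2l ?cabs_ge0//.
  exact: ler_norm.
apply: le_trans (F_lip rr (ltW zr1) wr) _.
by rewrite ler_piMl ?cabs_ge0// ltW// k1.
Qed.

(* A minimiser of [|F - w|] on the closed disk is a zero of [F - w], since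
   the step [c - l^-1 (F c - w)] would otherwise do better. *)
Lemma perturb_onto r w : 0 <= r < r2 -> cabs w <= S r ->
  exists2 z, cabs z <= r & F z = w.
Proof.
move=> rr wS; have /andP[r0 rr2] := rr.
have [|c cr cP] := @cball_min _ (fun z => F z - w) r r0.
  move=> z zr; have := @perturb_continuous z; rewrite DrE => /(_ _)Fc.
  have {}Fc := Fc (le_lt_trans zr rr2).
  apply/ccontinuousP => e e0.
  have [d d0 dP] := iffLR (ccontinuousP _ _) Fc e e0.
  by exists d => // v /dP; rewrite opprB addrA subrK.
exists c => //; have [h hE] := l_onto (F c - w).
(* The new point stays in the disk: |l (c - h)| <= |w| + |F c - l c| <= S r + (r - S r). *)
have lz' : l (c - h) = w - (F c - l c) by rewrite lB hE; ring.
have z'r : cabs (c - h) <= r.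
  apply: le_trans (l_ge _) _; rewrite lz'; apply: le_trans (cabsB _ _) _.
  by have := F_bound rr cr; lra.
have := cP _ z'r; have -> : F (c - h) - w =
    F (c - h) - l (c - h) - (F c - l c) by rewrite lz'; ring.
move=> /le_trans/(_ (F_lip rr cr z'r)); rewrite [c - h]addrC addrK cabsN => H.
have hF := l_ge h; rewrite hE in hF.
have kr := k1 rr; apply/eqP; rewrite -subr_eq0 -cabs_eq0.
apply/eqP/le_anti; rewrite cabs_ge0 andbT leNgt; apply/negP => Fc0.
(* The step multiplies the residual by at most [k r], so a nonzero residual contradicts minimality.
   The sign of [k r] is unknown, hence the two cases. *)
have : k r * cabs h < cabs (F c - w).
  have [k0|k0] := lerP (k r) 0.
    by apply: le_lt_trans Fc0; rewrite mulr_le0_ge0 ?cabs_ge0.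
  apply: le_lt_trans (ler_wpM2l (ltW k0) hF) _.
  by rewrite -[ltRHS]mul1r ltr_pM2r.
by move/(le_lt_trans H); rewrite ltxx.
Qed.

Lemma perturb_schlicht : has_schlicht_disk F r2 0 (S r2).
Proof.
(* The preimage of the target disk is open by continuity, and connected as the union of the lifts of
   the segments from 0. *)
split=> //; pose A : set R[i] := [set z | Dr r2 z /\ cabs (F z) < S r2].
have D0 : Dr r2 (0 : R[i]) by rewrite DrE cabs0.
have A0 : A 0 by split=> //; rewrite F0 cabs0.
(* Guarding the conclusion makes [choice] produce a total function; outside the target disk its
   values are arbitrary. *)
have onto w : exists z, cabs w < S r2 -> Dr r2 z /\ F z = w.
  have [wS|wS] := ltP (cabs w) (S r2); last by exists 0.
  have [r rr wr] := S_left wS; have [z zr zw] := perturb_onto rr wr.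
  by exists z; split=> //; rewrite DrE; case/andP: rr => _; exact: le_lt_trans.
have [Phi PhiP] := choice onto.
have PhiF z : A z -> Phi (F z) = z.
  move=> [zD zS]; have [PD PE] := PhiP _ zS.
  by apply: perturb_univalent; rewrite ?inE.
have AE : A = \bigcup_(z in A) ((fun t : R => Phi (t%:C * F z) : cplane R) @`
    `[0, 1]%classic).
  apply/seteqP; split=> z.
    move=> Az; exists z => //; exists 1; rewrite /= ?in_itv/= ?lexx ?ler01//.
    by rewrite mul1r PhiF.
  move=> [w [wD wS]] [t /=]; rewrite in_itv/= => /andP[t0 t1] <-.
  have tw : cabs (t%:C * F w) < S r2.
    apply: le_lt_trans wS; rewrite cabsM cabs_real ger0_norm//.
    by rewrite ler_piMl ?cabs_ge0.
  by have [? E] := PhiP _ tw; split=> //; rewrite E.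
exists A; split.
- split; first by exists 0.
    rewrite openE => z [zD zS]; apply/cnbhsP.
    have Sz : 0 < S r2 - cabs (F z) by rewrite subr_gt0.
    have [d d0 dP] := iffLR (ccontinuousP _ _) (perturb_continuous zD) _ Sz.
    move: zD; rewrite DrE => zr.
    exists (Num.min d (r2 - cabs z)); first by rewrite lt_min d0 subr_gt0.
    move=> w; rewrite lt_min => /andP[/dP Fw wz]; split.
      by rewrite DrE; have := ler_cabsB w z; lra.
    by have := ler_cabsB (F w) (F z); lra.
  rewrite AE; apply: bigcup_connected.
    exists 0 => z Az /=; exists 0; rewrite /= ?in_itv/= ?lexx ?ler01//.
    by rewrite mul0r -F0 PhiF.
  move=> z [zD zS]; apply: connected_continuous_connected.
    exact: segment_connected.
  (* One radius [r] serves the whole segment from 0 to [F z]; there [perturb_expand] makes [Phi]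
     Lipschitz with constant 1 / (1 - k r). *)
  have [r rr zr] := S_left zS; have kr : 0 < 1 - k r by rewrite subr_gt0 k1.
  have Pr t : t \in `[0, 1] -> cabs (Phi (t%:C * F z)) <= r /\
      F (Phi (t%:C * F z)) = t%:C * F z.
    rewrite in_itv/= => /andP[t0 t1].
    have tz : cabs (t%:C * F z) <= cabs (F z).
      by rewrite cabsM cabs_real ger0_norm// ler_piMl ?cabs_ge0.
    have [w wr wE] := perturb_onto rr (le_trans tz zr).
    have [PD PE] := PhiP _ (le_lt_trans tz zS).
    split=> //; rewrite (_ : Phi _ = w)//.
    apply: perturb_univalent; rewrite ?inE ?PE// DrE.
    by case/andP: rr => _; exact: le_lt_trans.
  apply/subspace_continuousP => t t01 U /cnbhsP[d d0 dU].
  have F1 : 0 < cabs (F z) + 1 by rewrite ltr_wpDl ?cabs_ge0.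
  apply/nbhs_ballP; exists (d * (1 - k r) / (cabs (F z) + 1)) => /=.
    by rewrite divr_gt0// mulr_gt0.
  move=> u; rewrite /ball/= ltr_pdivlMr// => ut u01; apply: dU.
  have [Pt Et] := Pr _ t01; have [Pu Eu] := Pr _ u01.
  have := perturb_expand rr Pt Pu.
  rewrite Et Eu -mulrBl -realcB cabsM cabs_real.
  rewrite distrC => H; rewrite -(ltr_pM2l kr); apply: le_lt_trans H _.
  rewrite [ltRHS]mulrC; apply: le_lt_trans ut.
  by rewrite ler_wpM2l// lerDl.
- by move=> z [].
- move=> z w; rewrite !inE => -[zD _] [wD _].
  by apply: perturb_univalent; rewrite inE.
- apply/seteqP; split=> [w [z [_ zS] <-]|w].
    by rewrite /cdisk/= subr0.
  rewrite /cdisk/= subr0 => wS; have [PD PE] := PhiP _ wS.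
  by exists (Phi w) => //; split=> //; rewrite PE.
Qed.

End linear_perturbation.

(** * The radii *)

Section radii.
Context {R : realType}.
Implicit Types (r s x : R).

Lemma sum_continuous_at (I : Type) (t : seq I) (f : I -> R -> R) x :
  (forall i, {for x, continuous (f i)}) ->
  {for x, continuous (fun r => \sum_(i <- t) f i r)}.
Proof.
move=> fc; elim: t => [|i t ih].
  rewrite (_ : (fun r => _) = fun=> 0); first exact: cvg_cst.
  by apply/funext => r; rewrite big_nil.
rewrite (_ : (fun r => _) = fun r => f i r + \sum_(j <- t) f j r).
  exact: (cvgD (fc i) ih).
by apply/funext => r; rewrite big_cons.
Qed.

(** After squaring, with u = 1 - r^2, this is the monotonicity of 2/u^3 + 1/u^2 + 1/u. *)
Lemma growth_ratio_le r s : 0 <= r -> r <= s -> 0 < s -> s < 1 ->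
  growth r <= r / s * growth s.
Proof.
move=> r0 rs s0 s1; rewrite !growthE ?r0 ?(ltW s0) ?(le_lt_trans rs)//.
have q0 : 0 <= r / s by rewrite divr_ge0// ltW.
rewrite -[r / s in leRHS](ger0_norm q0) -sqrtr_sqr -sqrtrM ?sqr_ge0//.
rewrite ler_wsqrtr//.
have xy : r ^+ 2 <= s ^+ 2 by rewrite lerXn2r ?nnegrE ?(ltW s0).
have y1 : s ^+ 2 < 1 by rewrite expr_lt1// ltW.
rewrite expr_div_n.
have -> : r ^+ 2 / s ^+ 2 * (s ^+ 2 * (4 - 3 * s ^+ 2 + (s ^+ 2) ^+ 2) /
   (1 - s ^+ 2) ^+ 3) = r ^+ 2 * ((4 - 3 * s ^+ 2 + (s ^+ 2) ^+ 2) /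
   (1 - s ^+ 2) ^+ 3).
  by field; apply/andP; split; rewrite gt_eqF ?subr_gt0.
rewrite -mulrA ler_wpM2l ?sqr_ge0//.
move: (r ^+ 2) (s ^+ 2) xy y1 => x y xy y1.
have v0 : 0 < 1 - y by rewrite subr_gt0.
have u0 : 0 < 1 - x by lra.
rewrite ler_pdivrMr ?exprn_gt0// mulrAC ler_pdivlMr ?exprn_gt0//.
have vu : 1 - y <= 1 - x by lra.
rewrite (_ : 4 - 3 * x + x ^+ 2 = 2 + (1 - x) + (1 - x) ^+ 2); last by ring.
rewrite (_ : 4 - 3 * y + y ^+ 2 = 2 + (1 - y) + (1 - y) ^+ 2); last by ring.
move: (1 - y) (1 - x) v0 u0 vu => v u v0 u0 vu.
have v2 : v ^+ 2 <= u ^+ 2 by rewrite lerXn2r ?nnegrE ?(ltW u0) ?(ltW v0).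
have v3 : v ^+ 3 <= u ^+ 3 by rewrite lerXn2r ?nnegrE ?(ltW u0) ?(ltW v0).
have uv0 : 0 < u * v by rewrite mulr_gt0.
have A : u * v * v ^+ 2 <= u * v * u ^+ 2 by rewrite ler_pM2l.
have B : (u * v) ^+ 2 * v <= (u * v) ^+ 2 * u by rewrite ler_pM2l ?exprn_gt0.
lra.
Qed.

(** With u = 1 - r^2 it reduces to 4 u^2 <= 2 + u + u^2, true for u <= 1. *)
Lemma growth_ge r : 0 < r < 1 -> 2 * (r / Num.sqrt (1 - r ^+ 2)) <= growth r.
Proof.
move=> /andP[r0 r1]; rewrite growthE ?r1 ?(ltW r0)//.
have u0 : 0 < 1 - r ^+ 2 by rewrite subr_gt0 expr_lt1// ltW.
have -> : 2 * (r / Num.sqrt (1 - r ^+ 2)) =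
    Num.sqrt ((2 * r) ^+ 2 / (1 - r ^+ 2)).
  rewrite sqrtrM ?sqr_ge0// sqrtrV ?(ltW u0)// sqrtr_sqr ger0_norm ?mulrA//.
  by rewrite mulr_ge0// ltW.
rewrite ler_wsqrtr// (_ : (2 * r) ^+ 2 / _ = r ^+ 2 * (4 / (1 - r ^+ 2))).
  2: by ring.
rewrite -[leRHS]mulrA.
rewrite ler_wpM2l ?sqr_ge0//.
rewrite (_ : 4 - 3 * r ^+ 2 + (r ^+ 2) ^+ 2 =
  2 + (1 - r ^+ 2) + (1 - r ^+ 2) ^+ 2); last by ring.
have : 1 - r ^+ 2 <= 1 by rewrite gerBl sqr_ge0.
move: (1 - r ^+ 2) u0 => u u0 u1.
rewrite ler_pdivrMr// mulrAC ler_pdivlMr ?exprn_gt0//.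
nra.
Qed.

Lemma growth0 : growth (0 : R) = 0.
Proof. by rewrite /growth !mul0r. Qed.

Variables (C : R) (c : nat -> R) (p : nat).
Hypothesis C0 : 0 <= C.
Hypothesis c0 : forall k, (2 <= k < p.+1)%N -> 0 <= c k.

(** Unfolds to [radius_fun] when [C] is sqrt(2 M^2 - 2) and [c k] is [Lambda'] at index [p - k + 1];
    likewise [disk_rad] and [schlicht_radius]. *)
Definition rad_fun r : R := 1 - C * growth r -
  \sum_(2 <= k < p.+1) (2 * k - 1)%N%:R * c k * r ^+ (2 * (k - 1)).

Definition disk_rad r : R := r - C * (r ^+ 2 / Num.sqrt (1 - r ^+ 2)) -
  \sum_(2 <= k < p.+1) r ^+ (2 * k - 1) * c k.

(** Each term of [1 - rad_fun r] is [r] times a nondecreasing function. Positivity before a root,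
    hence uniqueness, follows from [r / s < 1]. *)
Lemma rad_fun_ratio r s : 0 <= r -> r <= s -> 0 < s -> s < 1 ->
  1 - rad_fun r <= r / s * (1 - rad_fun s).
Proof.
move=> r0 rs s0 s1; have q0 : 0 <= r / s by rewrite divr_ge0// ltW.
rewrite /rad_fun.
have E (a b : R) : 1 - (1 - a - b) = a + b by ring.
rewrite !E mulrDr; apply: lerD.
  by rewrite [leRHS]mulrCA ler_wpM2l// growth_ratio_le.
rewrite mulr_sumr; apply: ler_sum_nat => k /[dup] k2 /andP[k2' _].
rewrite [leRHS]mulrCA ler_wpM2l ?mulr_ge0 ?c0//.
have -> : (2 * (k - 1) = (2 * (k - 2) + 1).+1)%N by lia.
rewrite ![_ ^+ _.+1]exprS mulrA divfK ?gt_eqF//.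
by rewrite ler_wpM2l// lerXn2r ?nnegrE// ltW.
Qed.

Lemma rad_fun_gt0 r s : 0 <= r < s -> 0 < s < 1 -> rad_fun s = 0 ->
  0 < rad_fun r.
Proof.
move=> /andP[r0 rs] /andP[s0 s1] s_root.
have := rad_fun_ratio r0 (ltW rs) s0 s1; rewrite s_root subr0 mulr1.
have : r / s < 1 by rewrite ltr_pdivrMr// mul1r.
lra.
Qed.

Lemma rad_fun_root_unique r s : 0 < r < 1 -> 0 < s < 1 ->
  rad_fun r = 0 -> rad_fun s = 0 -> r = s.
Proof.
move=> r01 s01 rr sr; have /andP[r0 _] := r01; have /andP[s0 _] := s01.
case: (ltgtP r s) => // rs.
  by have := @rad_fun_gt0 r s; rewrite rs (ltW r0) rr ltxx => /(_ isT s01 sr).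
by have := @rad_fun_gt0 s r; rewrite rs (ltW s0) sr ltxx => /(_ isT r01 rr).
Qed.

(** Since 2 <= 2k - 1, each term of the sum lost from [disk_rad] is at most r/2 times its
    counterpart in [rad_fun]; [growth_ge] does the same for the term with [C]. At a root the
    counterparts add up to 1, so at least r/2 is left. *)
Lemma disk_rad_gt0 r : 0 < r < 1 -> rad_fun r = 0 -> 0 < disk_rad r.
Proof.
move=> r01 rr; have /andP[r0 r1] := r01.
apply: (@lt_le_trans _ _ (r / 2)); first by rewrite divr_gt0.
have : C * (2 * (r / Num.sqrt (1 - r ^+ 2))) <= C * growth r.
  by rewrite ler_wpM2l// growth_ge.
have : 2 * (\sum_(2 <= k < p.+1) r ^+ (2 * k - 1) * c k) <=
    r * (\sum_(2 <= k < p.+1) (2 * k - 1)%N%:R * c k * r ^+ (2 * (k - 1))).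
  rewrite !mulr_sumr; apply: ler_sum_nat => k /[dup] k2 /andP[k2' _].
  have -> : (2 * k - 1 = (2 * (k - 1)).+1)%N by lia.
  rewrite exprS; set e := r ^+ _.
  have -> : 2 * (r * e * c k) = r * (2%:R * c k * e) by ring.
  rewrite ler_wpM2l ?(ltW r0)// ler_wpM2r ?exprn_ge0 ?(ltW r0)//.
  by rewrite ler_wpM2r ?c0// ler_nat; lia.
move: rr; rewrite /rad_fun /disk_rad.
set T := \sum_(2 <= k < p.+1) _; set U := \sum_(2 <= k < p.+1) _.
move=> E HU HG.
have -> : C * (r ^+ 2 / Num.sqrt (1 - r ^+ 2)) =
   r * (C * (r / Num.sqrt (1 - r ^+ 2))) by ring.
have : r * (2 * (C * (r / Num.sqrt (1 - r ^+ 2)))) <= r * (C * growth r).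
  by rewrite ler_pM2l// mulrCA.
have : r * (C * growth r) + r * T = r.
  by rewrite -mulrDr -[RHS]mulr1; congr (_ * _); lra.
move: HU; move: (r * T) (r * (C * growth r)) => a b.
rewrite [r * (2 * _)]mulrCA; lra.
Qed.

Lemma disk_rad_left r : 0 < r < 1 -> forall s, s < disk_rad r ->
  exists2 x, 0 <= x < r & s <= disk_rad x.
Proof.
move=> /andP[r0 r1] s sr; apply: contrapT => H.
have : - s <= - disk_rad r; last by lra.
apply: (@le_at_left R _ 0 r (fun x => - disk_rad x)) => //.
  have ids : x @[x --> r] --> r by exact: cvg_id.
  have cst (d : R) : d @[x --> r] --> d by exact: cvg_cst.
  have id2 (n : nat) : x ^+ n @[x --> r] --> r ^+ n by exact: exprn_continuous.
  apply: cvgN; apply: cvgB.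
    apply: cvgB => //; apply: cvgM => //; apply: cvgM => //.
    apply: cvgV.
      by rewrite gt_eqF// sqrtr_gt0 subr_gt0 expr_lt1// ltW.
    apply: continuous_cvg; first exact: sqrt_continuous.
    exact: cvgB.
  by apply: sum_continuous_at => k; apply: cvgM.
move=> x /andP[x0 xr]; rewrite lerN2 leNgt; apply/negP => sx; apply: H.
by exists x; rewrite ?(ltW x0) ?ltW.
Qed.

Lemma rad_fun0 : rad_fun 0 = 1.
Proof.
rewrite /rad_fun growth0 mulr0 subr0 big_nat big1 ?subr0// => k /andP[k2 _].
by rewrite expr0n; case: eqP; rewrite ?mulr0//; lia.
Qed.

Lemma growth_large d : 0 < d -> exists2 b : R, 0 < b < 1 & 1 <= d * growth b.
Proof.
(* [u] plays the role of 1 - b^2: the numerator is then at least 1, and u^3 <= u <= d^2. *)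
move=> d0; pose u := Num.min (1 / 2) (d ^+ 2).
have u0 : 0 < u by rewrite lt_min exprn_gt0// divr_gt0.
have u2 : u <= 1 / 2 by rewrite ge_min lexx.
have ud : u <= d ^+ 2 by rewrite ge_min lexx orbT.
clearbody u; have u1 : 0 < 1 - u by lra.
have b2 : Num.sqrt (1 - u) ^+ 2 = 1 - u by rewrite sqr_sqrtr// ltW.
have b0 : 0 < Num.sqrt (1 - u) by rewrite sqrtr_gt0.
have b1 : Num.sqrt (1 - u) < 1.
  by rewrite -(@ltr_pXn2r _ 2)// ?nnegrE ?ltW// b2 expr1n; lra.
exists (Num.sqrt (1 - u)); first by rewrite b0.
rewrite growthE; last by rewrite b1 ltW.
rewrite b2 -{1}(ger0_norm (ltW d0)) -sqrtr_sqr -sqrtrM ?sqr_ge0//.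
rewrite -[1 in leLHS]sqrtr1 ler_wsqrtr// (_ : 1 - (1 - u) = u); last by ring.
rewrite mulrA ler_pdivlMr ?exprn_gt0// mul1r.
have : u ^+ 2 <= 1 by rewrite expr_le1//; lra.
have : 1 <= (1 - u) * (4 - 3 * (1 - u) + (1 - u) ^+ 2) by nra.
move: (_ * _) => t t1 uu.
apply: (@le_trans _ _ (d ^+ 2 * 1)); last by rewrite ler_wpM2l ?sqr_ge0.
by rewrite mulr1; apply: le_trans ud; rewrite exprS ler_piMr// ltW.
Qed.

Lemma rad_fun_root_exists :
  0 < C \/ 1 < \sum_(2 <= k < p.+1) (2 * k - 1)%N%:R * c k ->
  exists2 r : R, 0 < r < 1 & rad_fun r = 0.
Proof.
(* A point with a nonpositive value, for the intermediate value theorem. If [0 < C] it comes from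
   the blow-up of [growth] at 1; if [C = 0], from the polynomial part, which is negative at 1. *)
move=> H; have [b /andP[b0 b1] fb] : exists2 b : R, 0 < b < 1 & rad_fun b <= 0.
  have [C1|C0'] := ltP 0 C.
    have [b b01 gb] := growth_large C1; exists b => //; have /andP[b0 _] := b01.
    rewrite /rad_fun -addrA -opprD subr_le0; apply: le_trans gb _.
    rewrite lerDl big_nat sumr_ge0// => k k2.
    by rewrite !mulr_ge0 ?c0// exprn_ge0// ltW.
  have {C0'}CE : C = 0 by apply/le_anti; rewrite C0' C0.
  case: H => [|H]; first by rewrite CE ltxx.
  apply: contrapT => nb.
  pose T x := 1 -
    \sum_(2 <= k < p.+1) (2 * k - 1)%N%:R * c k * x ^+ (2 * (k - 1)).
  have : 0 <= T 1.
    apply: (@le_at_left R 0 0 1 T) => //.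
      apply: cvgB; first exact: cvg_cst.
      apply: sum_continuous_at => k; apply: cvgM; first exact: cvg_cst.
      exact: exprn_continuous.
    move=> s s01; rewrite leNgt; apply/negP => Ts; apply: nb; exists s => //.
    by rewrite /rad_fun CE mul0r subr0 ltW.
  rewrite /T; under eq_bigr do rewrite expr1n mulr1.
  by rewrite subr_ge0 leNgt H.
(* [growth] with the real power turned into a square root, so that continuity follows from
   composition. *)
pose g x : R := x * Num.sqrt (x ^+ 4 - 3 * x ^+ 2 + 4) /
  Num.sqrt ((1 - x ^+ 2) * ((1 - x ^+ 2) * (1 - x ^+ 2))).
have gE x : 0 <= x < 1 -> growth x = g x.
  move=> /andP[x0 x1]; rewrite /growth /g powRrM powR12_sqrt ?powR_ge0//.
  by rewrite (powR_mulrn 3)// subr_ge0 expr_le1// ltW.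
pose f x := 1 - C * g x -
  \sum_(2 <= k < p.+1) (2 * k - 1)%N%:R * c k * x ^+ (2 * (k - 1)).
have fE x : 0 <= x < 1 -> rad_fun x = f x by move=> x01; rewrite /rad_fun gE.
have [||x x0b fx] := @IVT R f 0 b 0 (ltW b0).
- apply: continuous_in_subspaceT => x; rewrite inE/= in_itv/= => /andP[x0 xb].
  have ids : y @[y --> x] --> x by exact: cvg_id.
  have cst (d : R) : d @[y --> x] --> d by exact: cvg_cst.
  have idn (n : nat) : y ^+ n @[y --> x] --> x ^+ n by exact: exprn_continuous.
  apply: cvgB.
    apply: cvgB => //; apply: cvgM => //; apply: cvgM.
      apply: cvgM => //; apply: continuous_cvg; first exact: sqrt_continuous.
      by apply: cvgD => //; apply: cvgB => //; apply: cvgM.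
    apply: cvgV.
      have : 0 < 1 - x ^+ 2 by rewrite subr_gt0 expr_lt1// (le_lt_trans xb b1).
      by move=> u0; rewrite gt_eqF// sqrtr_gt0 !mulr_gt0.
    apply: continuous_cvg; first exact: sqrt_continuous.
    by apply: cvgM; [|apply: cvgM]; exact: cvgB.
  by apply: sum_continuous_at => k; apply: cvgM.
- have f0 : f 0 = 1 by rewrite -fE ?rad_fun0// lexx ltr01.
  have f1 : f b <= 0 by rewrite -fE// (ltW b0).
  by rewrite f0 ge_min f1 orbT le_max ler01.
move: x0b; rewrite in_itv/= => /andP[x0 xb].
have x1 : x < 1 := le_lt_trans xb b1.
have fx' : rad_fun x = 0 by rewrite fE ?x0.
exists x => //; rewrite x1 andbT lt_def x0 andbT.
by apply/eqP => E; move: fx'; rewrite E rad_fun0 => /eqP; rewrite oner_eq0.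
Qed.

End radii.

(** * Extremal mappings *)

Section linear_maps.
Context {R : realType}.
Implicit Types (z w a b : R[i]).
Local Notation I := (0 +i* 1 : R[i]).
Local Notation Re := (@complex.Re R).
Local Notation Im := (@complex.Im R).
Local Notation disk := (@Dr R 1).

Lemma has_cderiv_horiz_affine a b y x :
  has_cderiv (horiz_line (fun z => a * z + b) y) x a.
Proof.
have := has_cderiv_line (a * (0 +i* y) + b) a x.
congr has_cderiv; apply/funext => t; rewrite /horiz_line.
have -> : t +i* y = t%:C + (0 +i* y) :> R[i].
  by apply: complexP; rewrite !ReImE/= ?addr0 ?add0r.
by ring.
Qed.

Lemma has_cderiv_vert_affine a b y x :
  has_cderiv (vert_line (fun z => a * z + b) x) y (a * I).
Proof.
have := has_cderiv_line (a * x%:C + b) (a * I) y.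
congr has_cderiv; apply/funext => t; rewrite /vert_line.
have -> : x +i* t = x%:C + t%:C * I :> R[i].
  by apply: complexP; rewrite !ReImE/=; ring.
by ring.
Qed.

Lemma dx_affine a b : dx (fun z => a * z + b) = fun=> a.
Proof. by apply/funext => z; apply/dx_horiz/has_cderiv_horiz_affine. Qed.

Lemma dy_affine a b : dy (fun z => a * z + b) = fun=> a * I.
Proof. by apply/funext => z; apply/dy_vert/has_cderiv_vert_affine. Qed.

Lemma C1_affine (A : set R[i]) a b : C1_on A (fun z => a * z + b).
Proof.
have cst c z : ccontinuous_at (fun=> c) z.
  by apply/ccontinuousP => e e0; exists 1 => // w _; rewrite subrr cabs0.
move=> z _; split; rewrite ?dx_affine ?dy_affine//.
  by have /has_cderivP[] := has_cderiv_horiz_affine a b (Im z) (Re z).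
by have /has_cderivP[] := has_cderiv_vert_affine a b (Im z) (Re z).
Qed.

(** Makes the affine lemmas apply to the partial derivatives of an affine map. *)
Lemma cst_affine a : (fun=> a) = (fun z => 0 * z + a).
Proof. by apply/funext => z; rewrite mul0r add0r. Qed.

Lemma harmonic_affine a b : harmonic_mapping (fun z => a * z + b).
Proof.
split; last first.
  move=> z _; rewrite /laplacian dx_affine dy_affine.
  rewrite (cst_affine a) (cst_affine (a * I)) dx_affine dy_affine.
  by rewrite mul0r addr0.
split; first exact: C1_affine.
  by rewrite dx_affine (cst_affine a); exact: C1_affine.
by rewrite dy_affine (cst_affine (a * I)); exact: C1_affine.
Qed.

Lemma dz_affine a b z : dz (fun z => a * z + b) z = a.
Proof.
rewrite /dz dx_affine dy_affine mulrCA.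
by rewrite I2 mulrN1 opprK -mulr2n -[a *+ 2]mulr_natr mulfK.
Qed.

Lemma dzbar_affine a b z : dzbar (fun z => a * z + b) z = 0.
Proof.
by rewrite /dzbar dx_affine dy_affine mulrCA I2 mulrN1 subrr mul0r.
Qed.

Lemma lambda_affine a b z : lambda (fun z => a * z + b) z = cabs a.
Proof.
by rewrite /lambda dz_affine dzbar_affine cabs0 subr0 ger0_norm// cabs_ge0.
Qed.

Lemma abs_continuous_affine (g : R -> R[i]) (d : R[i]) (a b : R) :
  (forall s t, g t - g s = d * (t - s)%:C) -> abs_continuous a b g.
Proof.
move=> gE e e0; have d1 : 0 < cabs d + 1 by rewrite ltr_wpDl ?cabs_ge0.
exists (e / (cabs d + 1)); first by rewrite divr_gt0.
move=> n s t st _; rewrite ltr_pdivlMr// mulrC; apply: le_lt_trans.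
rewrite mulr_sumr; apply: ler_sum => i _; have [_ [sti _]] := st i.
rewrite gE cabsM cabs_real ger0_norm ?subr_ge0// ler_wpM2r ?subr_ge0//.
by rewrite lerDl.
Qed.

Lemma square_integrable_cst (a b c d x : R) : a <= b -> c <= d ->
  square_integrable (rect a b c d) (fun=> x).
Proof.
move=> ab cd; split; first exact: measurable_cst.
rewrite integral_cst; last exact: measurable_rect.
by rewrite area_rect// -EFinM ltry.
Qed.

Lemma ACL2_affine a b : ACL2 (fun z => a * z + b).
Proof.
split.
- move=> x1 x2 y1 y2 _; split; apply: aeW => /= u _.
    apply: (@abs_continuous_affine _ a) => s t; rewrite /horiz_line.
    have -> : (t - s)%:C = (t +i* u) - (s +i* u) :> R[i].
      by apply: complexP; rewrite !ReImE/= ?subrr.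
    by ring.
  apply: (@abs_continuous_affine _ (a * I)) => s t; rewrite /vert_line.
  have E : I * (t - s)%:C = (u +i* t) - (u +i* s) :> R[i].
    by apply: complexP; rewrite !ReImE/=; ring.
  by rewrite -mulrA E; ring.
- move=> x1 x2 y1 y2 [xx yy _]; rewrite dx_affine.
  by split; apply: square_integrable_cst; exact: ltW.
- move=> x1 x2 y1 y2 [xx yy _]; rewrite dy_affine.
  by split; apply: square_integrable_cst; exact: ltW.
Qed.

Lemma elliptic_harmonic_linear a : a != 0 ->
  elliptic_harmonic 1 0 (fun z : R[i] => a * z).
Proof.
move=> a0.
have E : (fun z : R[i] => a * z) = (fun z => a * z + 0).
  by apply/funext => z; rewrite addr0.
have J z : wirtinger_jac (fun z => a * z + 0) z = cabs a ^+ 2.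
  by rewrite /wirtinger_jac dz_affine dzbar_affine cabs0 expr0n subr0.
rewrite E; split; last exact: harmonic_affine; split.
- by move=> z _; rewrite J sqr_ge0.
- by move=> z zD; apply: C1_continuous => //; exact: C1_affine.
- split; first exact: ACL2_affine.
  by apply: aeW => q _; rewrite J expf_neq0// cabs_eq0.
- apply: aeW => q _; rewrite J /bigLambda dz_affine dzbar_affine cabs0.
  by rewrite !addr0 mul1r.
Qed.

End linear_maps.

(** * Radial profile of the extremal mapping *)

Section extremal.
Context {R : realType}.
Variables (c : nat -> R) (p : nat).
Hypothesis c0 : forall k, (2 <= k < p.+1)%N -> 0 <= c k.
Implicit Types (x y r : R).

Definition profile x : R := x - \sum_(2 <= k < p.+1) x ^+ (2 * k - 1) * c k.

(** Convexity of the power, by induction on the exponent. *)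
Lemma pow_ge_tangent x y n : 0 <= x -> 0 <= y ->
  n.+1%:R * y ^+ n * (x - y) <= x ^+ n.+1 - y ^+ n.+1.
Proof.
move=> x0 y0; elim: n => [|n ih]; first by rewrite mulr1 mul1r.
have := ler_wpM2l x0 ih; rewrite -[n.+2%:R]natr1.
have : 0 <= n.+1%:R * y ^+ n * (x - y) ^+ 2.
  by rewrite mulr_ge0 ?sqr_ge0// mulr_ge0 ?exprn_ge0.
rewrite [x ^+ n.+2]exprS [y ^+ n.+2]exprS ![y ^+ n.+1]exprS.
by move: (x ^+ n.+1) (y ^+ n) (n.+1%:R) => u v m; lra.
Qed.

(** At a root the slopes (2k-1) c_k r^(2k-2) add up to 1, so the weighted tangent inequalities at
    [r] sum to the claim. *)
Lemma profile_le r x : 0 <= r -> 0 <= x -> rad_fun 0 c p r = 0 ->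
  profile x <= profile r.
Proof.
move=> r0 x0; rewrite /rad_fun mul0r subr0 => /eqP; rewrite subr_eq0 => /eqP E.
rewrite -subr_ge0 /profile.
have -> (a b d e : R) : a - b - (d - e) = (e - b) - (d - a) by ring.
rewrite -sumrB -[x - r]mul1r {1}E mulr_suml subr_ge0.
apply: ler_sum_nat => k /[dup] k2 /andP[k2' _].
have -> : (2 * k - 1 = (2 * (k - 1)).+1)%N by lia.
have := ler_wpM2r (c0 k2) (pow_ge_tangent (2 * (k - 1)) x0 r0).
by rewrite -mulrBl; congr (_ <= _); ring.
Qed.

Lemma profile_ge0 r x : 0 <= x -> x <= r -> rad_fun 0 c p r = 0 ->
  0 <= profile x.
Proof.
move=> x0 xr; rewrite /rad_fun mul0r subr0 => /eqP; rewrite subr_eq0 => /eqP E.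
rewrite /profile subr_ge0 -[leRHS]mulr1 E mulr_sumr.
apply: ler_sum_nat => k /[dup] k2 /andP[k2' _].
have -> : (2 * k - 1 = (2 * (k - 1)).+1)%N by lia.
rewrite exprS -mulrA ler_wpM2l// mulrC [_ * c k]mulrC -mulrA.
rewrite ler_wpM2l ?c0//.
apply: (@le_trans _ _ (r ^+ (2 * (k - 1)))).
  by rewrite lerXn2r ?nnegrE// (le_trans x0).
by rewrite ler_peMl ?exprn_ge0 ?(le_trans x0)// ler1n.
Qed.

Lemma profile_continuous x : {for x, continuous profile}.
Proof.
apply: cvgB; first exact: cvg_id.
apply: sum_continuous_at => k; apply: cvgM; last exact: cvg_cst.
exact: exprn_continuous.
Qed.

Lemma profile0 : profile 0 = 0.
Proof.
rewrite /profile sub0r big_nat big1 ?oppr0// => k /andP[k2 _].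
by rewrite expr0n; case: eqP; rewrite ?mul0r//; lia.
Qed.

(** Take [y] just past the maximum. If its value is nonnegative, it is already taken on [[0, r]]; if
    it is negative, the value 0 taken at 0 recurs between [r] and [y]. *)
Lemma profile_not_injective r s : 0 < r -> r < s -> rad_fun 0 c p r = 0 ->
  exists x y, [/\ 0 <= x < s, 0 <= y < s, x != y & profile x = profile y].
Proof.
move=> r0 rs rr; pose y := (r + s) / 2.
have /andP[ry ys] : r < y < s by rewrite /y; lra.
have y0 : 0 < y := lt_trans r0 ry.
have cont (A : set R) : {within A, continuous profile}.
  by apply: continuous_subspaceT => x; exact: profile_continuous.
have yr : profile y <= profile r by apply: profile_le => //; exact: ltW.
have r_ge0 := @profile_ge0 r r (ltW r0) (lexx _) rr.
have [vy|vy] := leP 0 (profile y).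
  have [|x] := @IVT R profile 0 r (profile y) (ltW r0) (cont _).
    by rewrite profile0 ge_min vy le_max yr orbT.
  rewrite in_itv/= => /andP[x0 xr] E; exists x, y.
  by rewrite x0 (le_lt_trans xr)//= (ltW y0) ys lt_eqF// (le_lt_trans xr).
have [|x] := @IVT R profile r y 0 (ltW ry) (cont _).
  by rewrite ge_min (ltW vy) orbT le_max r_ge0.
rewrite in_itv/= => /andP[xr xy] E; exists x, 0.
rewrite profile0 lexx (lt_trans r0 rs) (le_lt_trans xy ys).
rewrite gt_eqF ?(lt_le_trans r0)//.
by rewrite (le_trans (ltW r0)).
Qed.

End extremal.

(** * Sums of weighted harmonic mappings *)

Section poly_sum.
Context {R : realType}.
Implicit Types (z w h : R[i]) (f : R[i] -> R[i]) (r : R).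
Local Notation I := (0 +i* 1 : R[i]).
Local Notation disk := (@Dr R 1).

Lemma fdiffB f z0 z w : fdiff f z0 (w - z) = fdiff f z0 w - fdiff f z0 z.
Proof. by rewrite !fdiffE cconjB; ring. Qed.

Lemma fdiff_ge f z0 h : lambda f z0 * cabs h <= cabs (fdiff f z0 h).
Proof.
rewrite fdiffE /lambda.
have := ler_cabsB (dz f z0 * h) (- (dzbar f z0 * h^*)).
have := ler_cabsB (dzbar f z0 * h^*) (- (dz f z0 * h)).
rewrite !opprK !cabsN [X in _ - cabs X]mulrC !cabsM cabs_conj.
rewrite [X in _ <= cabs X -> _]addrC -mulrBl => H1 H2.
by case: ger0P => _; lra.
Qed.

(** Cramer's rule, with the real determinant d = |a|^2 - |b|^2. *)
Lemma real_linear_onto (a b w : R[i]) : cabs a != cabs b ->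
  exists h, a * h + b * h^* = w.
Proof.
move=> ab.
have [d dE dc] : exists2 d : R[i], d = a * a^* - b * b^* & d^* = d.
  by exists (a * a^* - b * b^*); rewrite // !mul_conjc -realcB conjc_real.
have d0 : d != 0.
  rewrite dE !mul_conjc -realcB -cabs_eq0 cabs_real normr_eq0 subr_eq0.
  by rewrite eqrXn2 ?cabs_ge0.
exists ((a^* * w - b * w^*) * d^-1).
rewrite [(_ * d^-1)^*]cconjM conjc_inv dc cconjB !cconjM !conjcK.
have -> : a * ((a^* * w - b * w^*) * d^-1) +
    b * ((a * w^* - b^* * w) * d^-1) = (a * a^* - b * b^*) * d^-1 * w by ring.
by rewrite -dE mulfV// mul1r.
Qed.

Lemma fdiff_onto f z0 w : lambda f z0 != 0 -> exists h, fdiff f z0 h = w.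
Proof.
rewrite normr_eq0 subr_eq0 => /(@real_linear_onto _ _ w)[h hE].
by exists h; rewrite fdiffE.
Qed.

(** An error of order h^2 leaves the first derivative unchanged; the bound at h = 0 also gives equal
    values. *)
Lemma has_cderiv_perturb (u v : R -> R[i]) d (C : R) : has_cderiv u 0 d ->
  (forall h : R, `|h| < 1 -> cabs (v h - u h) <= C * h ^+ 2) ->
  has_cderiv v 0 d.
Proof.
move=> /has_cderiv_epsP ud uv; apply/has_cderiv_epsP => e e0.
have e20 : 0 < e / 2 by rewrite divr_gt0.
have C0 : 0 < `|C| + 1 by rewrite ltr_wpDl.
have [a a0 aP] := ud _ e20.
exists (Num.min a (Num.min 1 (e / 2 / (`|C| + 1)))).
  by rewrite !lt_min a0 ltr01 divr_gt0.
move=> h; rewrite !lt_min ltr_pdivlMr// => /and3P[ha h1 he].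
have v0 : v 0 = u 0.
  apply/eqP; rewrite -subr_eq0 -cabs_eq0; apply/eqP/le_anti.
  by rewrite cabs_ge0 andbT; have := uv 0; rewrite normr0 expr0n mulr0; apply.
rewrite !add0r v0 in aP *.
have -> : v h - u 0 - h%:C * d = (u h - u 0 - h%:C * d) + (v h - u h) by ring.
have := aP h ha; rewrite add0r => H.
apply: le_trans (cabsD _ _) _; rewrite (splitr e) mulrDl; apply: lerD => //.
apply: le_trans (uv _ h1) _.
rewrite -(real_normK (num_real h)) expr2 mulrA ler_wpM2r//.
apply: le_trans (ltW he); rewrite mulrC ler_wpM2l//.
by apply: le_trans (ler_norm _) _; rewrite lerDl.
Qed.

Variables (p : nat) (G : nat -> R[i] -> R[i]) (c : nat -> R).
Hypothesis c0 : forall k, (2 <= k < p.+1)%N -> 0 <= c k.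
Hypothesis G0 : forall k, (2 <= k < p.+1)%N -> G (p - k + 1)%N 0 = 0.
Hypothesis GL : forall k, (2 <= k < p.+1)%N -> forall z w, disk z -> disk w ->
  cabs (G (p - k + 1)%N w - G (p - k + 1)%N z) <= c k * cabs (w - z).

Definition ptail z : R[i] :=
  \sum_(2 <= k < p.+1) `|z| ^+ (2 * (k - 1)) * G (p - k + 1)%N z.

Lemma ptail_lipschitz r : 0 <= r < 1 -> forall z w,
  cabs z <= r -> cabs w <= r -> cabs (ptail w - ptail z) <=
  (\sum_(2 <= k < p.+1) (2 * k - 1)%N%:R * c k * r ^+ (2 * (k - 1))) *
  cabs (w - z).
Proof.
move=> r01 z w zr wr; rewrite /ptail -sumrB mulr_suml.
apply: le_trans (cabs_sum _ _ _) _; apply: ler_sum_nat => k k2.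
have := weighted_lipschitz (2 * (k - 1)) (c0 k2) r01 (G0 k2) (GL k2) zr wr.
by have -> : (2 * k - 1 = (2 * (k - 1)).+1)%N by case/andP: k2; lia.
Qed.

Lemma ptail_bound r : 0 <= r < 1 -> forall z, cabs z <= r ->
  cabs (ptail z) <= \sum_(2 <= k < p.+1) r ^+ (2 * k - 1) * c k.
Proof.
move=> r01 z zr; apply: le_trans (cabs_sum _ _ _) _.
apply: ler_sum_nat => k k2.
have := weighted_bound (2 * (k - 1)) (c0 k2) r01 (G0 k2) (GL k2) zr.
by have -> : (2 * k - 1 = (2 * (k - 1)).+1)%N by case/andP: k2; lia.
Qed.

Lemma ptail_sqr z : disk z ->
  cabs (ptail z) <= (\sum_(2 <= k < p.+1) c k) * cabs z ^+ 2.
Proof.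
rewrite DrE => z1; have zz : 0 <= cabs z < 1 by rewrite cabs_ge0.
apply: le_trans (ptail_bound zz (lexx _)) _; rewrite mulr_suml.
apply: ler_sum_nat => k k2; rewrite mulrC ler_wpM2l ?c0//.
have -> : (2 * k - 1 = (2 * k - 3) + 2)%N by case/andP: k2; lia.
by rewrite exprD ler_piMl ?sqr_ge0// exprn_ile1 ?cabs_ge0// ltW.
Qed.

Variable F : R[i] -> R[i].
Hypothesis hp : (1 <= p)%N.
Hypothesis FE : forall z, disk z -> F z =
  \sum_(1 <= k < p.+1) `|z| ^+ (2 * (k - 1)) * G (p - k + 1)%N z.

Lemma ptailE z : disk z -> F z = G p z + ptail z.
Proof.
by move=> zD; rewrite FE// big_ltn// subnn muln0 expr0 mul1r subnK.
Qed.

(** All exponents 2k - 1 in the tail are at least 3, so it is O(|z|^2), and [F] and [G p] have the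
    same partial derivatives at 0. *)
Lemma poly_lambda0 : C1_on disk (G p) -> lambda F 0 = lambda (G p) 0.
Proof.
move=> GC; have d00 : disk 0 by rewrite DrE cabs0.
pose C := \sum_(2 <= k < p.+1) c k.
have FG z (h : R) : cabs z = `|h| -> `|h| < 1 ->
    cabs (F z - G p z) <= C * h ^+ 2.
  move=> zh h1; have zD : disk z by rewrite DrE zh.
  rewrite ptailE// addrAC subrr add0r -(real_normK (num_real h)) -zh.
  exact: ptail_sqr.
have x0 : dx F 0 = dx (G p) 0.
  apply: dx_horiz; apply: (has_cderiv_perturb (C := C) (C1_horiz GC d00)) => h.
  by apply: FG; rewrite -cabs_real.
have y0 : dy F 0 = dy (G p) 0.
  apply: dy_vert; apply: (has_cderiv_perturb (C := C) (C1_vert GC d00)) => h.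
  by apply: FG; rewrite cabsE/= expr0n/= add0r sqrtr_sqr.
by rewrite /lambda /dz /dzbar x0 y0.
Qed.

End poly_sum.

Section extremal_map.
Context {R : realType}.
Implicit Types (z w : R[i]) (r x : R).
Local Notation disk := (@Dr R 1).
Variables (p : nat) (L : nat -> R).
Hypothesis hp : (1 <= p)%N.
Hypothesis L0 : forall k, (2 <= k < p.+1)%N -> 0 < L (p - k + 1)%N.
Let c k := Lambda' 1 0 L (p - k + 1)%N.

(** sqrt(L^2) = L by positivity, so [Lambda'] is the mean of two equal numbers. *)
Lemma extremal_coef k : (2 <= k < p.+1)%N -> c k = L (p - k + 1)%N.
Proof.
move=> k2; rewrite /c /Lambda' expr1n !mul1r mulr0 addr0 sqrtr_sqr.
by rewrite ger0_norm ?(ltW (L0 k2))// -mulr2n -[_ *+ 2]mulr_natr mulfK.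
Qed.

(** Every tail component opposes the head [z] with the largest [lambda] allowed. *)
Definition extremal_part (j : nat) z : R[i] :=
  (if j == p then 1 else - (L j)%:C) * z.

Definition extremal_map z : R[i] :=
  \sum_(1 <= k < p.+1) `|z| ^+ (2 * (k - 1)) * extremal_part (p - k + 1)%N z.

Lemma extremal_part_tail k z : (2 <= k < p.+1)%N ->
  extremal_part (p - k + 1)%N z = - (L (p - k + 1)%N)%:C * z.
Proof. by move=> k2; rewrite /extremal_part; case: eqP => //; lia. Qed.

Lemma extremal_part_head z : extremal_part p z = z.
Proof. by rewrite /extremal_part eqxx mul1r. Qed.

Lemma extremal_mapE z : extremal_map z =
  (1 - \sum_(2 <= k < p.+1) c k * cabs z ^+ (2 * (k - 1)))%:C * z.
Proof.
rewrite /extremal_map big_ltn// subnn muln0 expr0 mul1r subnK//.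
rewrite extremal_part_head realcB mulrBl mul1r; congr (_ + _).
rewrite realc_sum mulr_suml -sumrN; apply: eq_big_nat => k k2.
by rewrite extremal_part_tail// -extremal_coef// norm_cabs realcM realcX; ring.
Qed.

Lemma profileE x : (1 - \sum_(2 <= k < p.+1) c k * x ^+ (2 * (k - 1))) * x =
  profile c p x.
Proof.
rewrite mulrBl mul1r /profile mulr_suml; congr (_ - _).
apply: eq_big_nat => k k2.
have -> : (2 * k - 1 = (2 * (k - 1)).+1)%N by case/andP: k2; lia.
by rewrite exprSr; ring.
Qed.

Lemma extremal_map_real x : 0 <= x ->
  extremal_map x%:C = (profile c p x)%:C.
Proof.
by move=> x0; rewrite extremal_mapE cabs_real ger0_norm// -realcM profileE.
Qed.

Lemma cabs_extremal_map z : cabs (extremal_map z) = `|profile c p (cabs z)|.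
Proof.
rewrite extremal_mapE cabsM cabs_real -profileE normrM.
by rewrite [`|cabs z|]ger0_norm ?cabs_ge0.
Qed.

Lemma extremal_lambda j z :
  lambda (extremal_part j) z = if j == p then 1 else `|L j|.
Proof.
have -> : extremal_part j =
    fun z => (if j == p then 1 else - (L j)%:C) * z + 0.
  by apply/funext => w; rewrite addr0.
by rewrite lambda_affine; case: ifP; rewrite ?cabs1// cabsN cabs_real.
Qed.

Lemma extremal_elliptic k : (1 <= k <= p)%N ->
  elliptic_harmonic 1 0 (extremal_part (p - k + 1)%N).
Proof.
move=> k1; apply: elliptic_harmonic_linear; case: ifPn => [_|/eqP kp].
  exact: oner_neq0.
by rewrite oppr_eq0 -cabs_eq0 cabs_real normr_eq0 gt_eqF// L0//; lia.
Qed.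

Lemma extremal_admissible :
  admissible 1 0 p L 1 extremal_part extremal_map.
Proof.
have cL k : (2 <= k < p.+1)%N -> 0 <= L (p - k + 1)%N by move=> /L0/ltW.
split.
- by split; [exact: extremal_elliptic|].
- split; first by rewrite extremal_mapE mulr0.
  rewrite (@poly_lambda0 R p extremal_part (fun k => L (p - k + 1)%N))//.
  + by rewrite extremal_lambda eqxx.
  + by move=> k _; rewrite /extremal_part mulr0.
  + move=> k k2 z w _ _; rewrite !extremal_part_tail// -mulrBr cabsM cabsN.
    by rewrite cabs_real ger0_norm ?cL.
  + have := @C1_affine R disk 1 0; congr C1_on; apply/funext => z.
    by rewrite extremal_part_head mul1r addr0.
- by move=> k _; rewrite /extremal_part mulr0.
- move=> k k2 z _; rewrite extremal_lambda ifF; last by apply/eqP; lia.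
  by rewrite ger0_norm// cL.
- by move=> z; rewrite DrE extremal_part_head => /ltW.
Qed.

Lemma extremal_c0 k : (2 <= k < p.+1)%N -> 0 <= c k.
Proof. by move=> k2; rewrite extremal_coef// ltW// L0. Qed.

Lemma extremal_not_univalent r s : 0 < r -> r < s -> rad_fun 0 c p r = 0 ->
  ~ univalent (Dr s) extremal_map.
Proof.
move=> r0 rs rr uni.
have [x [y [/andP[x0 xs] /andP[y0 ys] xy E]]] :=
  profile_not_injective extremal_c0 r0 rs rr.
have D t : 0 <= t -> t < s -> t%:C \in Dr s.
  by move=> t0 ts; rewrite inE DrE cabs_real ger0_norm.
have /complex_inj/eqP := uni x%:C y%:C (D _ x0 xs) (D _ y0 ys)
  ltac:(by rewrite !extremal_map_real// E).
by rewrite (negPf xy).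
Qed.

(** On |z| < r the modulus of the map is the profile at |z|, at most [profile c p r]; the real point
    [t] chosen beyond that value is missed. *)
Lemma extremal_no_schlicht r rho : 0 < r -> rad_fun 0 c p r = 0 ->
  profile c p r < rho -> ~ has_schlicht_disk extremal_map r 0 rho.
Proof.
move=> r0 rr rrho [rho0 [A [_ Ar _ FA]]].
have pr0 := profile_ge0 extremal_c0 (ltW r0) (lexx r) rr.
pose t := (profile c p r + rho) / 2.
have /andP[pt trho] : profile c p r < t < rho by rewrite /t; lra.
have : cdisk 0 rho t%:C.
  by rewrite /cdisk/= subr0 cabs_real ger0_norm// (le_trans pr0)// ltW.
rewrite -FA => -[z /Ar]; rewrite DrE => zr /(congr1 cabs).
rewrite cabs_extremal_map cabs_real ger0_norm; last first.
  by apply: profile_ge0 rr; [exact: extremal_c0|exact: cabs_ge0|exact: ltW].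
rewrite ger0_norm ?(le_trans pr0 (ltW pt))// => E.
have := profile_le extremal_c0 (ltW r0) (cabs_ge0 z) rr.
by rewrite E leNgt pt.
Qed.

End extremal_map.

(** In the case excluded from existence there is no root: the square root vanishes for [M = 1], and
    a coefficient sum at most 1 keeps [radius_fun] positive on (0, 1). *)
Theorem theorem2p2 (R : realType) (K K' : R) (p : nat)
    (G : nat -> R[i] -> R[i]) (F : R[i] -> R[i]) (L : nat -> R) (M : R)
    (hK : 1 <= K) (hK' : 0 <= K') (hp : (1 <= p)%N)
    (hF : admissible K K' p L M G F) :
  (~ (M = 1 /\
      \sum_(2 <= k < p.+1) (2 * k - 1)%N%:R * Lambda' K K' L (p - k + 1)%N
        <= 1) ->
   exists r2 : R, radius_root K K' p L M r2) /\
  forall r2 : R, radius_root K K' p L M r2 ->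
    [/\ (forall r : R, radius_root K K' p L M r -> r = r2),
        univalent (Dr r2) F,
        exists w : R[i],
          has_schlicht_disk F r2 w (schlicht_radius K K' p L M r2) &
        K = 1 -> K' = 0 -> M = 1 ->
          (forall r : R, r2 < r <= 1 ->
             exists (G0 : nat -> R[i] -> R[i]) (F0 : R[i] -> R[i]),
               admissible K K' p L M G0 F0 /\ ~ univalent (Dr r) F0) /\
          (forall rho : R, schlicht_radius K K' p L M r2 < rho ->
             exists (G0 : nat -> R[i] -> R[i]) (F0 : R[i] -> R[i]),
               admissible K K' p L M G0 F0 /\
               ~ has_schlicht_disk F0 r2 0 rho)].
Proof.
have [[GE FE] [F00 Fl] G00 GL GM] := hF.
have range k : (2 <= k < p.+1)%N -> (1 <= k <= p)%N by lia.
pose c k := Lambda' K K' L (p - k + 1)%N.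
have bound k (k2 : (2 <= k < p.+1)%N) :=
  elliptic_bound hK hK' (GE k (range k k2)) (GL k k2).
have L0 k : (2 <= k < p.+1)%N -> 0 < L (p - k + 1)%N by move=> /bound[].
have c0 k : (2 <= k < p.+1)%N -> 0 <= c k.
  move=> k2; rewrite /c /Lambda' divr_ge0// addr_ge0 ?sqrtr_ge0//.
  by rewrite mulr_ge0 ?(ltW (L0 k k2))//; lra.
have Gc k : (2 <= k < p.+1)%N -> forall z w, Dr 1 z -> Dr 1 w ->
    cabs (G (p - k + 1)%N w - G (p - k + 1)%N z) <= c k * cabs (w - z).
  move=> k2; apply: C1_lipschitz; first by have [_ [[]]] := GE k (range k k2).
  by have [_] := bound k k2.
have G0 k : (2 <= k < p.+1)%N -> G (p - k + 1)%N 0 = 0 by move=> /range/G00.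
have p1 : (p - 1 + 1)%N = p by rewrite subnK.
have [_ gH] : elliptic_harmonic K K' (G p).
  by rewrite -p1; apply: GE; rewrite hp.
have g0 : G p 0 = 0 by rewrite -p1; apply: G00; rewrite hp.
have gl : lambda (G p) 0 = 1.
  by rewrite -(poly_lambda0 c0 G0 Gc hp FE)//; case: gH => -[].
have M1 := bound_ge1 gH g0 gl GM.
pose C := Num.sqrt (2 * M ^+ 2 - 2).
have C0 : 0 <= C := sqrtr_ge0 _.
split.
  move=> nM; have [|r r01 rr] := rad_fun_root_exists (p := p) C0 c0; last first.
    by exists r.
  (* As [1 <= M], either [1 < M] and [0 < C], or [M = 1] and the assumption puts the coefficient sum
     above 1. *)
  have [MM|MM] := ltP 1 M; first by left; rewrite sqrtr_gt0; nra.
  right; rewrite ltNge; apply/negP => H; apply: nM; split=> //.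
  exact/le_anti/andP.
move=> r2 [r201 rr].
have rr' : rad_fun C c p r2 = 0 := rr.
have /andP[r20 r21] := r201.
have lt1 r : 0 <= r < r2 -> 0 <= r < 1.
  by move=> /andP[-> rr2]; rewrite (lt_trans rr2).
have tail z : cabs z < 1 ->
    F z - fdiff (G p) 0 z = (G p z - fdiff (G p) 0 z) + ptail p G z.
  by move=> z1; rewrite (ptailE hp FE) ?DrE//; ring.
(* The linear map to be perturbed is the differential of [G p] at 0, and the contraction factor at
   radius [r] is [1 - rad_fun C c p r]. *)
have lB := @fdiffB R (G p) 0.
have l_ge h : cabs h <= cabs (fdiff (G p) 0 h).
  by have := fdiff_ge (G p) 0 h; rewrite gl mul1r.
have k1 r : 0 <= r < r2 -> 1 - rad_fun C c p r < 1.
  by move=> r0; rewrite gtrBl; apply: rad_fun_gt0 rr'.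
have F_lip r : 0 <= r < r2 -> forall z w, cabs z <= r -> cabs w <= r ->
    cabs (F w - fdiff (G p) 0 w - (F z - fdiff (G p) 0 z)) <=
    (1 - rad_fun C c p r) * cabs (w - z).
  move=> /lt1 r0 z w zr wr; have /andP[_ r1] := r0.
  rewrite !tail ?(le_lt_trans zr r1) ?(le_lt_trans wr r1)//.
  rewrite [X in cabs X](_ : _ = (G p w - fdiff (G p) 0 w -
    (G p z - fdiff (G p) 0 z)) + (ptail p G w - ptail p G z)); last by ring.
  have -> : 1 - rad_fun C c p r = C * growth r + \sum_(2 <= k < p.+1)
      (2 * k - 1)%N%:R * c k * r ^+ (2 * (k - 1)) by rewrite /rad_fun; ring.
  apply: le_trans (cabsD _ _) _; rewrite mulrDl; apply: lerD.
    exact: harmonic_lipschitz.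
  exact: (ptail_lipschitz c0 G0 Gc).
have F_bound r : 0 <= r < r2 -> forall z, cabs z <= r ->
    cabs (F z - fdiff (G p) 0 z) <= r - disk_rad C c p r.
  move=> /lt1 r0 z zr; have /andP[_ r1] := r0.
  rewrite tail ?(le_lt_trans zr r1)//; apply: le_trans (cabsD _ _) _.
  have -> : r - disk_rad C c p r = C * (r ^+ 2 / Num.sqrt (1 - r ^+ 2)) +
      \sum_(2 <= k < p.+1) r ^+ (2 * k - 1) * c k by rewrite /disk_rad; ring.
  by apply: lerD; [exact: harmonic_dist_linear|exact: (ptail_bound c0 G0 Gc)].
split.
- by move=> r [r01 rr1]; apply: rad_fun_root_unique rr1 rr.
- exact: (perturb_univalent lB l_ge k1 F_lip).
- exists 0; apply: (perturb_schlicht (k := fun r => 1 - rad_fun C c p r)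
    (S := disk_rad C c p) lB l_ge (cabs_fdiff (G p) 0) _ F00 r20 _ k1 F_lip
    F_bound).
  + by move=> w; apply: fdiff_onto; rewrite gl oner_eq0.
  + exact: disk_rad_gt0.
  + exact: disk_rad_left.
- move=> KE K'E ME; subst K K' M.
  have CE : C = 0 by rewrite /C expr1n mulr1 subrr sqrtr0.
  rewrite CE in rr'.
  have adm := extremal_admissible hp L0.
  split=> [r /andP[r2r _]|rho].
    exists (extremal_part p L), (extremal_map p L); split=> //.
    exact: (extremal_not_univalent hp L0 r20 r2r rr').
  rewrite /schlicht_radius -/C CE mul0r subr0 => rrho.
  exists (extremal_part p L), (extremal_map p L); split=> //.
  exact: (extremal_no_schlicht hp L0 r20 rr').
Qed.
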